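(* Let $(A,\Delta)$ be an algebraic quantum group of compact type whose Haar state $\varphi$ is tracial. If the von Neumann algebra $M$ of $(A,\Delta)$ is injective, then the dual algebraic quantum group $(\hat A,\hat\Delta)$ is amenable.
   Context: Algebras are associative over $\mathbf C$, not necessarily unital. $\otimes$ is the algebraic tensor product for $*$-algebras, the Hilbert space tensor product for Hilbert spaces; $\bar\otimes$ is the von Neumann algebra tensor product; $\iota$ is an identity map. A non-zero algebra $A$ is non-degenerate if $a=0$ whenever $ab=0$ for all $b$, or $ba=0$ for all $b$. For a non-degenerate $*$-algebra $A$, $M(A)$ is the unital $*$-algebra of linear maps $x:A\to A$ for which there is a linear $y=x^*:A\to A$ with $x(a)^*b=a^*y(b)$ for all $a,b$; $A$ embeds in $M(A)$ by left multiplication, and $M(A)=A$ iff $A$ is unital. A homomorphism $\pi:A\to B$ of such algebras is non-degenerate if $\pi(A)B$ and $B\pi(A)$ each span $B$; it then extends uniquely to $M(A)\to M(B)$ by $\pi(x)(\pi(a)b)=\pi(xa)b$. A multiplier Hopf $*$-algebra is a pair $(A,\Delta)$, where $A$ is a non-degenerate $*$-algebra and $\Delta:A\to M(A\otimes A)$ is a non-degenerate $*$-homomorphism with $(\Delta\otimes\iota)\Delta=(\iota\otimes\Delta)\Delta$ and such that $a\otimes b\mapsto\Delta(a)(b\otimes1)$ and $a\otimes b\mapsto\Delta(a)(1\otimes b)$ define linear bijections of $A\otimes A$ onto itself. Its co-unit $\varepsilon:A\to\mathbf C$ is the unique non-zero $*$-homomorphism with $(\varepsilon\otimes\iota)\Delta(a)=(\iota\otimes\varepsilon)\Delta(a)=a$;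 its antipode $S$ is the unique anti-multiplicative linear isomorphism of $A$ with $m(S\otimes\iota)(\Delta(a)(1\otimes b))=\varepsilon(a)b=m(\iota\otimes S)((b\otimes1)\Delta(a))$, $m$ being multiplication. A linear functional $\omega$ on $A$ is left invariant if $(\iota\otimes\omega)\Delta(a)=\omega(a)1$ for all $a$ (where $(\iota\otimes\omega)(\Delta(a))\,b=(\iota\otimes\omega)(\Delta(a)(b\otimes1))$). An algebraic quantum group is a multiplier Hopf $*$-algebra admitting a non-zero left-invariant positive linear functional $\varphi$ (a left Haar integral); it is automatically faithful and unique up to a positive scalar. $(A,\Delta)$ is of compact type if $A$ is unital; then the Haar state is the unique left Haar integral $\varphi$ with $\varphi(1)=1$ (it is also right invariant). Tracial means $\varphi(ab)=\varphi(ba)$ for all $a,b\in A$. A GNS pair $(H,\Lambda)$ for $\varphi$: a Hilbert space $H$ and a linear map $\Lambda:A\to H$ with dense range with $(\Lambda(a),\Lambda(b))=\varphi(b^*a)$. There is a unique $*$-homomorphism $\pi:A\to B(H)$ with $\pi(a)\Lambda(b)=\Lambda(ab)$. $M=\pi(A)''$ is the von Neumann algebra of $(A,\Delta)$; it is injective if there is a norm-one idempotent linear map $E:B(H)\to B(H)$ with range $M$. The multiplicative unitary $W$ on $H\otimes H$ is the unique unitary with $W((\Lambda\otimes\Lambda)(\Delta(b)(a\otimes1)))=\Lambda(a)\otimes\Lambda(b)$ for all $a,b\in A$. Dual: $\hat A=\{a\varphi: a\in A\}\subseteq A'$ (linear functionals on $A$), where $(a\varphi)(b)=\varphi(ba)$;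 it is a non-degenerate $*$-algebra with $\omega_1\omega_2=(\omega_1\otimes\omega_2)\Delta$ and $\omega^*(a)=\overline{\omega(S(a)^* )}$. $\hat\Delta:\hat A\to M(\hat A\otimes\hat A)$ is the unique $*$-homomorphism with $((\omega_1\otimes1)\hat\Delta(\omega_2))(a\otimes b)=(\omega_1\otimes\omega_2)(\Delta(a)(1\otimes b))$ and $(\hat\Delta(\omega_1)(1\otimes\omega_2))(a\otimes b)=(\omega_1\otimes\omega_2)((a\otimes1)\Delta(b))$. $(\hat A,\hat\Delta)$ is an algebraic quantum group. Its von Neumann algebra is realized on the same $H$: with $\hat\Lambda(a\varphi)=\Lambda(a)$, let $\hat\pi:\hat A\to B(H)$ be the $*$-homomorphism with $\hat\pi(x)\hat\Lambda(y)=\hat\Lambda(xy)$; then $\hat M=\hat\pi(\hat A)''$, with co-multiplication $\hat\Delta_{\mathrm r}:\hat M\to\hat M\bar\otimes\hat M$, $\hat\Delta_{\mathrm r}(x)=W(x\otimes1)W^*$. $(\hat A,\hat\Delta)$ is amenable if it admits a right-invariant mean: a state $m$ on $\hat M$ with $m((\iota\bar\otimes\omega)\hat\Delta_{\mathrm r}(x))=\omega(1)m(x)$ for all $x\in\hat M$, $\omega\in\hat M_*$. *)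

(* Defs.v *)
From HB Require Import structures.
From mathcomp Require Import all_boot all_order all_algebra complex.
From mathcomp Require Import generic_quotient.
From mathcomp Require Import all_classical reals topology normedtype sequences.

Set Implicit Arguments.
Unset Strict Implicit.
Unset Printing Implicit Defensive.

Import Order.TTheory GRing.Theory Num.Theory.
Import numFieldNormedType.Exports.

Local Open Scope ring_scope.
Local Open Scope classical_set_scope.
Local Open Scope quotient_scope.

Declare Scope qgroup_scope.
Delimit Scope qgroup_scope with QG.
Local Open Scope qgroup_scope.

Definition lspan (K : nzRingType) (V : lmodType K) (X : set V) : set V :=
  [set v | exists s : seq (K * V),
     (forall p, p \in s -> X p.2) /\ v = \sum_(p <- s) p.1 *: p.2].

Section Tensor.
Variables (K : comNzRingType) (A B : lmodType K).

Definition balanced (V : zmodType) (f : A -> B -> V) : Prop :=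
  [/\ forall a a' b, f (a + a') b = f a b + f a' b,
      forall a b b', f a (b + b') = f a b + f a b'
    & forall (k : K) a b, f (k *: a) b = f a (k *: b)].

(* A formal sum of elementary tensors is a list of pairs; two formal sums are
   identified when no balanced biadditive map separates them. *)
Definition tensor_eqv (s t : seq (A * B)) : bool :=
  `[< forall (V : zmodType) (f : A -> B -> V), balanced f ->
      \sum_(p <- s) f p.1 p.2 = \sum_(p <- t) f p.1 p.2 >].

Lemma tensor_eqv_refl : reflexive tensor_eqv.
Proof. by move=> s; apply/asboolP. Qed.

Lemma tensor_eqv_sym : symmetric tensor_eqv.
Proof.
by move=> s t; apply/asboolP/asboolP => h V f bf; rewrite h.
Qed.

Lemma tensor_eqv_trans : transitive tensor_eqv.
Proof.
move=> t s u /asboolP h1 /asboolP h2; apply/asboolP => V f bf.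
by rewrite h1 // h2.
Qed.

Canonical tensor_equiv :=
  EquivRel tensor_eqv tensor_eqv_refl tensor_eqv_sym tensor_eqv_trans.

Definition tensor : Type := {eq_quot tensor_equiv}.

HB.instance Definition _ := Choice.on tensor.
HB.instance Definition _ := EqQuotient.on tensor.

Implicit Types x y z : tensor.

Definition tens (a : A) (b : B) : tensor := \pi_tensor [:: (a, b)].

(* For balanced f, this is independent of the chosen representative. *)
Definition tlift (V : zmodType) (f : A -> B -> V) x : V :=
  \sum_(p <- repr x) f p.1 p.2.

Lemma tlift_pi (V : zmodType) (f : A -> B -> V) (s : seq (A * B)) :
  balanced f -> tlift f (\pi_tensor s) = \sum_(p <- s) f p.1 p.2.
Proof.
move=> bf; rewrite /tlift; case: piP => t /eqmodP /asboolP h.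
exact/esym/h.
Qed.

Lemma tlift_tens (V : zmodType) (f : A -> B -> V) a b :
  balanced f -> tlift f (tens a b) = f a b.
Proof. by move=> bf; rewrite tlift_pi // big_seq1. Qed.

Lemma tensor_ext x y :
  (forall (V : zmodType) (f : A -> B -> V), balanced f ->
     tlift f x = tlift f y) -> x = y.
Proof.
move=> h; rewrite -[x]reprK -[y]reprK; apply/eqmodP/asboolP => V f bf.
exact: h.
Qed.

Definition tadd x y : tensor := \pi_tensor (repr x ++ repr y).
Definition tzero : tensor := \pi_tensor [::].
Definition tscale (k : K) x : tensor :=
  \pi_tensor [seq (k *: p.1, p.2) | p <- repr x].
Definition topp x : tensor := tscale (-1) x.

Lemma tlift_tadd (V : zmodType) (f : A -> B -> V) x y :
  balanced f -> tlift f (tadd x y) = tlift f x + tlift f y.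
Proof. by move=> bf; rewrite tlift_pi // big_cat. Qed.

Lemma tlift_tzero (V : zmodType) (f : A -> B -> V) :
  balanced f -> tlift f tzero = 0.
Proof. by move=> bf; rewrite tlift_pi // big_nil. Qed.

Lemma tlift_tscale (V : zmodType) (f : A -> B -> V) k x :
  balanced f -> tlift f (tscale k x) = tlift (fun a b => f (k *: a) b) x.
Proof. by move=> bf; rewrite tlift_pi // big_map. Qed.

Lemma balancedZ (V : zmodType) (f : A -> B -> V) k :
  balanced f -> balanced (fun a b => f (k *: a) b).
Proof.
case=> h1 h2 h3; split=> [a a' b|a b b'|l a b].
- by rewrite scalerDr h1.
- by rewrite h2.
- by rewrite scalerA mulrC -scalerA h3.
Qed.

Lemma balanced0l (V : zmodType) (f : A -> B -> V) b : balanced f -> f 0 b = 0.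
Proof. by case=> h1 _ _; apply: (addrI (f 0 b)); rewrite -h1 !addr0. Qed.

Lemma balancedNl (V : zmodType) (f : A -> B -> V) a b :
  balanced f -> f (- a) b = - f a b.
Proof.
move=> bf; apply/eqP; rewrite -addr_eq0; case: (bf) => h1 _ _.
by rewrite -h1 addNr balanced0l.
Qed.

Lemma tlift_topp (V : zmodType) (f : A -> B -> V) x :
  balanced f -> tlift f (topp x) = - tlift f x.
Proof.
move=> bf; rewrite tlift_tscale // /tlift -sumrN; apply: eq_bigr => p _.
by rewrite scaleN1r balancedNl.
Qed.

Lemma taddA : associative tadd.
Proof.
by move=> x y z; apply: tensor_ext => V f bf; rewrite !tlift_tadd // addrA.
Qed.

Lemma taddC : commutative tadd.
Proof.
by move=> x y; apply: tensor_ext => V f bf; rewrite !tlift_tadd // addrC.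
Qed.

Lemma tadd0 : left_id tzero tadd.
Proof.
move=> x; apply: tensor_ext => V f bf.
by rewrite tlift_tadd // tlift_tzero // add0r.
Qed.

Lemma taddN : left_inverse tzero topp tadd.
Proof.
move=> x; apply: tensor_ext => V f bf.
by rewrite tlift_tadd // tlift_tzero // tlift_topp // addNr.
Qed.

HB.instance Definition _ :=
  GRing.isZmodule.Build tensor taddA taddC tadd0 taddN.

Lemma tscaleA k l x : tscale k (tscale l x) = tscale (k * l) x.
Proof.
apply: tensor_ext => V f bf.
rewrite !tlift_tscale //; last exact: balancedZ.
by apply: eq_bigr => p _; rewrite scalerA.
Qed.

Lemma tscale1 : left_id 1 tscale.
Proof.
move=> x; apply: tensor_ext => V f bf; rewrite tlift_tscale //.
by apply: eq_bigr => p _; rewrite scale1r.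
Qed.

Lemma tscaleDr : right_distributive tscale +%R.
Proof.
move=> k x y; apply: tensor_ext => V f bf.
have bkf := balancedZ k bf.
by rewrite [RHS]tlift_tadd // !tlift_tscale // [LHS]tlift_tadd.
Qed.

Lemma tscaleDl x : {morph tscale^~ x : k l / k + l >-> k + l}.
Proof.
move=> k l; apply: tensor_ext => V f bf.
rewrite [RHS]tlift_tadd // !tlift_tscale // /tlift -big_split.
by apply: eq_bigr => p _; rewrite scalerDl; case: bf => ->.
Qed.

HB.instance Definition _ := GRing.Zmodule_isLmodule.Build K tensor
  tscaleA tscale1 tscaleDr tscaleDl.

Lemma tliftD (V : zmodType) (f : A -> B -> V) x y :
  balanced f -> tlift f (x + y) = tlift f x + tlift f y.
Proof. exact: tlift_tadd. Qed.

Lemma tlift0 (V : zmodType) (f : A -> B -> V) : balanced f -> tlift f 0 = 0.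
Proof. exact: tlift_tzero. Qed.

Lemma tliftZ (V : lmodType K) (f : A -> B -> V) k x :
  balanced f -> (forall a b, f (k *: a) b = k *: f a b) ->
  tlift f (k *: x) = k *: tlift f x.
Proof.
move=> bf hf; rewrite [LHS]tlift_tscale // /tlift scaler_sumr.
by apply: eq_bigr.
Qed.

Lemma balanced_tens : balanced tens.
Proof.
split=> [a a' b|a b b'|k a b]; apply: tensor_ext => V f bf;
  rewrite ?[RHS]tlift_tadd // !tlift_tens //; by case: bf.
Qed.

Lemma tensDl a a' b : tens (a + a') b = tens a b + tens a' b.
Proof. by case: balanced_tens. Qed.

Lemma tensDr a b b' : tens a (b + b') = tens a b + tens a b'.
Proof. by case: balanced_tens. Qed.

Lemma tensZl k a b : tens (k *: a) b = k *: tens a b.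
Proof.
apply: tensor_ext => V f bf.
rewrite [RHS]tlift_tscale // !tlift_tens //; exact: balancedZ.
Qed.

Lemma tensZr k a b : tens a (k *: b) = k *: tens a b.
Proof. by rewrite -tensZl; case: balanced_tens. Qed.

Lemma tensor_sum x : x = \sum_(p <- repr x) tens p.1 p.2.
Proof.
apply: tensor_ext => V f bf; rewrite {1}/tlift.
elim: (repr x) => [|p s IH]; first by rewrite !big_nil tlift0.
by rewrite !big_cons tliftD // tlift_tens // IH.
Qed.

Lemma tensor_ind (P : tensor -> Prop) :
  P 0 -> (forall a b x, P x -> P (tens a b + x)) -> forall x, P x.
Proof.
move=> P0 PS x; rewrite (tensor_sum x).
elim: (repr x) => [|p s IH]; first by rewrite big_nil.
by rewrite big_cons; apply: PS.
Qed.

End Tensor.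

Notation "a ⊗ b" := (tens a b) (at level 40, left associativity) : qgroup_scope.

Definition tmap (K : comNzRingType) (A B A' B' : lmodType K)
    (f : A -> A') (g : B -> B') : tensor A B -> tensor A' B' :=
  tlift (fun a b => f a ⊗ g b).

Definition tassoc (K : comNzRingType) (A B C : lmodType K) :
    tensor (tensor A B) C -> tensor A (tensor B C) :=
  tlift (fun x c => tlift (fun a b => a ⊗ (b ⊗ c)) x).

HB.mixin Record Lmodule_isStarAlgebra (R : realType) A
    of GRing.Lmodule R[i] A := {
  amul : A -> A -> A;
  astar : A -> A;
  amulA : associative amul;
  amulDl : left_distributive amul +%R;
  amulDr : right_distributive amul +%R;
  amulZl : forall (k : R[i]) a b, amul (k *: a) b = k *: amul a b;
  amulZr : forall (k : R[i]) a b, amul a (k *: b) = k *: amul a b;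
  astarK : involutive astar;
  astarD : {morph astar : a b / a + b};
  astarZ : forall (k : R[i]) a, astar (k *: a) = k^* *: astar a;
  astarM : forall a b, astar (amul a b) = amul (astar b) (astar a)
}.

#[short(type="starAlgType")]
HB.structure Definition StarAlgebra (R : realType) :=
  {A of GRing.Lmodule R[i] A & Lmodule_isStarAlgebra R A}.

Notation "a ∙ b" := (amul a b) (at level 40, left associativity) : qgroup_scope.
Notation "a ^⋆" := (astar a) (at level 2, format "a ^⋆") : qgroup_scope.

Section TensorStar.
Variables (R : realType) (A B : starAlgType R).

Lemma balanced_tmap (A' B' : lmodType R[i]) (f : A -> A') (g : B -> B') :
  linear f -> linear g -> balanced (fun a b => f a ⊗ g b).
Proof.
move=> lf lg.
have fD a a' : f (a + a') = f a + f a' by have := lf 1 a a'; rewrite !scale1r.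
have gD a a' : g (a + a') = g a + g a' by have := lg 1 a a'; rewrite !scale1r.
have f0 : f 0 = 0 by apply: (addrI (f 0)); rewrite -fD !addr0.
have g0 : g 0 = 0 by apply: (addrI (g 0)); rewrite -gD !addr0.
have fZ k a : f (k *: a) = k *: f a by have := lf k a 0; rewrite f0 !addr0.
have gZ k a : g (k *: a) = k *: g a by have := lg k a 0; rewrite g0 !addr0.
by split=> *; rewrite ?fD ?gD ?fZ ?gZ ?tensDl ?tensDr ?tensZl ?tensZr.
Qed.

Lemma amul_linear (C : starAlgType R) (a : C) : linear (amul a).
Proof. by move=> k x y; rewrite amulDr amulZr. Qed.

Definition tmul (x y : tensor A B) : tensor A B :=
  tlift (fun a b => tmap (amul a) (amul b) y) x.

Definition tstar : tensor A B -> tensor A B := tlift (fun a b => a^⋆ ⊗ b^⋆).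

Let bmap a b : balanced (fun (c : A) (d : B) => (a ∙ c) ⊗ (b ∙ d)).
Proof. by apply: balanced_tmap; exact: amul_linear. Qed.

Let bmul y : balanced (fun (a : A) (b : B) => tmap (amul a) (amul b) y).
Proof.
split=> [a a' b|a b b'|k a b]; elim/tensor_ind: y => [|c d y IH];
  rewrite /tmap ?tlift0 ?addr0 // !tliftD // !tlift_tens // -?/(tmap _ _ _) IH.
- by rewrite amulDl tensDl addrACA.
- by rewrite amulDl tensDr addrACA.
- by rewrite !amulZl tensZl tensZr.
Qed.

Let bstar : balanced (fun (a : A) (b : B) => a^⋆ ⊗ b^⋆).
Proof.
by split=> *; rewrite ?astarD ?astarZ ?tensDl ?tensDr ?tensZl ?tensZr.
Qed.

Let tmulDl : left_distributive tmul +%R.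
Proof. by move=> x y z; rewrite /tmul tliftD. Qed.

Let tmulDr : right_distributive tmul +%R.
Proof.
move=> x y z; rewrite /tmul /tlift -big_split; apply: eq_bigr => p _ /=.
by rewrite /tmap tliftD.
Qed.

Let tmul0l x : tmul 0 x = 0.
Proof. by rewrite /tmul tlift0. Qed.

Let tmul0r x : tmul x 0 = 0.
Proof. by apply: (addrI (tmul x 0)); rewrite -tmulDr !addr0. Qed.

Lemma tmul_tens a b c d : tmul (a ⊗ b) (c ⊗ d) = (a ∙ c) ⊗ (b ∙ d).
Proof. by rewrite /tmul tlift_tens // /tmap tlift_tens. Qed.

Lemma tstar_tens a b : tstar (a ⊗ b) = a^⋆ ⊗ b^⋆.
Proof. by rewrite /tstar tlift_tens. Qed.

Let tmulA : associative tmul.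
Proof.
move=> x y z; elim/tensor_ind: x => [|a b x IH]; first by rewrite !tmul0l.
rewrite !tmulDl IH; congr (_ + _) => {x IH}; elim/tensor_ind: y => [|c d y IH].
  by rewrite !(tmul0l, tmul0r).
rewrite !(tmulDl, tmulDr) IH; congr (_ + _) => {y IH}.
elim/tensor_ind: z => [|e f z IH]; first by rewrite !tmul0r.
by rewrite !tmulDr IH !tmul_tens !amulA.
Qed.

Let tmulZl (k : R[i]) x y : tmul (k *: x) y = k *: tmul x y.
Proof.
apply: tliftZ => // a b; elim/tensor_ind: y => [|c d y IH].
  by rewrite /tmap !tlift0 // scaler0.
rewrite /tmap !tliftD // !tlift_tens // -!/(tmap _ _ _) IH scalerDr.
by rewrite amulZl tensZl.
Qed.

Let tmulZr (k : R[i]) x y : tmul x (k *: y) = k *: tmul x y.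
Proof.
elim/tensor_ind: x => [|a b x IH]; first by rewrite !tmul0l scaler0.
rewrite !tmulDl IH scalerDr; congr (_ + _).
rewrite /tmul !tlift_tens //; apply: tliftZ => // c d.
by rewrite amulZr tensZl.
Qed.

Let tstarD : {morph tstar : x y / x + y}.
Proof. by move=> x y; rewrite /tstar tliftD. Qed.

Let tstar0 : tstar 0 = 0.
Proof. by rewrite /tstar tlift0. Qed.

Let tstarZ (k : R[i]) x : tstar (k *: x) = k^* *: tstar x.
Proof.
elim/tensor_ind: x => [|a b x IH]; first by rewrite scaler0 tstar0 scaler0.
rewrite scalerDr !tstarD IH scalerDr; congr (_ + _).
by rewrite -tensZl !tstar_tens astarZ tensZl.
Qed.

Let tstarK : involutive tstar.
Proof.
elim/tensor_ind => [|a b x IH]; first by rewrite !tstar0.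
by rewrite !tstarD IH !tstar_tens !astarK.
Qed.

Let tstarM x y : tstar (tmul x y) = tmul (tstar y) (tstar x).
Proof.
elim/tensor_ind: x => [|a b x IH]; first by rewrite tmul0l tstar0 tmul0r.
rewrite tmulDl !tstarD tmulDr IH; congr (_ + _) => {x IH}.
elim/tensor_ind: y => [|c d y IH]; first by rewrite tmul0r tstar0 tmul0l.
rewrite tmulDr !tstarD tmulDl IH; congr (_ + _).
by rewrite !tmul_tens !tstar_tens tmul_tens !astarM.
Qed.

HB.instance Definition _ := Lmodule_isStarAlgebra.Build R (tensor A B)
  tmulA tmulDl tmulDr tmulZl tmulZr tstarK tstarD tstarZ tstarM.

End TensorStar.

(* M(A) is realized as a set of maps A -> A: its product is composition, its
   unit is the identity, and a in A is identified with [amul a]. *)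
Section Multipliers.
Variable R : realType.

Definition nondegenerate (A : starAlgType R) : Prop :=
  [/\ exists a : A, a != 0,
      forall a : A, (forall b, a ∙ b = 0) -> a = 0
    & forall a : A, (forall b, b ∙ a = 0) -> a = 0].

Definition multiplier_adjoint (A : starAlgType R) (x y : A -> A) : Prop :=
  forall a b, (x a)^⋆ ∙ b = a^⋆ ∙ y b.

Definition multiplier (A : starAlgType R) : set (A -> A) :=
  [set x | linear x /\ exists2 y, linear y & multiplier_adjoint x y].

Definition mult_starhom (A B : starAlgType R) (f : A -> B -> B) : Prop :=
  [/\ linear f, forall a, multiplier (f a),
      forall a b, f (a ∙ b) = f a \o f b
    & forall a, multiplier_adjoint (f a) (f a^⋆)].

Definition mult_nondegenerate (A B : starAlgType R) (f : A -> B -> B) : Prop :=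
  lspan [set u | exists a b, u = f a b] = setT /\
  lspan [set u | exists a b, amul u = amul b \o f a] = setT.

(* y is the image of the multiplier x under the extension M(A) -> M(B) of f *)
Definition mult_extends (A B : starAlgType R) (f : A -> B -> B)
    (x : A -> A) (y : B -> B) : Prop :=
  multiplier y /\ forall a b, y (f a b) = f (x a) b.

Definition is_unit (A : starAlgType R) (e : A) : Prop :=
  forall a, e ∙ a = a /\ a ∙ e = a.

End Multipliers.

Section QuantumGroups.
Variables (R : realType) (A : starAlgType R).
Variable Delta : A -> tensor A A -> tensor A A.

Definition Delta_id (x : tensor A A) :
    tensor (tensor A A) A -> tensor (tensor A A) A :=
  tlift (fun a b => tmap (Delta a) (amul b)) x.

Definition id_Delta (x : tensor A A) :
    tensor A (tensor A A) -> tensor A (tensor A A) :=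
  tlift (fun a b => tmap (amul a) (Delta b)) x.

Definition coassociative : Prop :=
  forall a, exists y z, [/\ mult_extends Delta_id (Delta a) y,
    mult_extends id_Delta (Delta a) z
    & forall t, tassoc (y t) = z (tassoc t)].

(* u is the element Delta(a)(b ⊗ 1), resp. Delta(a)(1 ⊗ b), of A ⊗ A *)
Definition is_Delta_l (a b : A) (u : tensor A A) : Prop :=
  amul u = Delta a \o tmap (amul b) id.
Definition is_Delta_r (a b : A) (u : tensor A A) : Prop :=
  amul u = Delta a \o tmap id (amul b).

Definition multiplier_hopf : Prop :=
  [/\ nondegenerate A,
      mult_starhom Delta /\ mult_nondegenerate Delta,
      coassociative,
      exists T : {linear tensor A A -> tensor A A},
        bijective T /\ forall a b, is_Delta_l a b (T (a ⊗ b))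
    & exists T : {linear tensor A A -> tensor A A},
        bijective T /\ forall a b, is_Delta_r a b (T (a ⊗ b))].

Definition left_invariant (w : {scalar A}) : Prop :=
  forall a b u, is_Delta_l a b u ->
    tlift (fun c d => w d *: c) u = w a *: b.

Definition positive_functional (w : {scalar A}) : Prop :=
  forall a, 0 <= w (a^⋆ ∙ a).

Definition left_haar (w : {scalar A}) : Prop :=
  [/\ exists a, w a != 0, positive_functional w & left_invariant w].

Definition algebraic_quantum_group : Prop :=
  multiplier_hopf /\ exists w, left_haar w.

Definition compact_type : Prop :=
  algebraic_quantum_group /\ exists e : A, is_unit e.

Definition haar_state (w : {scalar A}) : Prop :=
  left_haar w /\ forall e, is_unit e -> w e = 1.

Definition tracial (w : {scalar A}) : Prop :=
  forall a b, w (a ∙ b) = w (b ∙ a).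

End QuantumGroups.

HB.mixin Record CompleteNormedModule_isHilbert (R : realType) H
    of CompleteNormedModule R[i] H := {
  hdot : H -> H -> R[i];
  hdotPl : forall (k : R[i]) x y z,
    hdot (k *: x + y) z = k * hdot x z + hdot y z;
  hdotC : forall x y, hdot y x = (hdot x y)^*;
  hdot_norm : forall x, hdot x x = `|x| ^+ 2
}.

#[short(type="hilbertType")]
HB.structure Definition Hilbert (R : realType) :=
  {H of CompleteNormedModule R[i] H & CompleteNormedModule_isHilbert R H}.

Section Operators.
Variables (R : realType) (H : hilbertType R).

Definition BH : set (H -> H) := [set T | linear T /\ continuous T].

Definition adjoint_pair (T S : H -> H) : Prop :=
  forall x y, hdot (T x) y = hdot x (S y).

Definition unitary (T : H -> H) : Prop :=
  [/\ linear T, forall y, exists x, T x = y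
    & forall x y, hdot (T x) (T y) = hdot x y].

Definition commutant (X : set (H -> H)) : set (H -> H) :=
  [set T | BH T /\ forall S, X S -> T \o S = S \o T].

Definition bicommutant (X : set (H -> H)) := commutant (commutant X).

Definition opnorm (T : H -> H) : R :=
  sup [set complex.Re `|T x| | x in [set x | `|x| <= 1]].

Definition injective_vN (N : set (H -> H)) : Prop :=
  exists E : (H -> H) -> (H -> H),
  [/\ forall (k : R[i]) S T, BH S -> BH T -> E (k *: S + T) = k *: E S + E T,
      forall T, BH T -> E (E T) = E T,
      E @` BH = N
    & sup [set opnorm (E T) | T in [set T | BH T /\ opnorm T <= 1]] = 1].

Definition state (N : set (H -> H)) (m : (H -> H) -> R[i]) : Prop :=
  [/\ forall (k : R[i]) S T, N S -> N T -> m (k *: S + T) = k * m S + m T,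
      forall T S, N T -> adjoint_pair T S -> 0 <= m (S \o T)
    & m id = 1].

Definition square_summable (x : nat -> H) : Prop :=
  exists r : R[i], forall n, \sum_(0 <= k < n) `|x k| ^+ 2 <= r.

Definition series_to (u : nat -> R[i]) (l : R[i]) : Prop :=
  (series u : nat -> R[i]^o) @ \oo --> (l : R[i]^o).

(* w T = sum_n (T xi_n, eta_n) on N: these are the normal (ultraweakly
   continuous) functionals on N, i.e. the elements of the predual of N. *)
Definition normal_repr (N : set (H -> H)) (w : (H -> H) -> R[i])
    (xi eta : nat -> H) : Prop :=
  [/\ square_summable xi, square_summable eta
    & forall T, N T -> series_to (fun n => hdot (T (xi n)) (eta n)) (w T)].

Definition predual (N : set (H -> H)) : set ((H -> H) -> R[i]) :=
  [set w | exists xi eta, normal_repr N w xi eta].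

End Operators.

Section HilbertTensor.
Variables (R : realType) (H K : hilbertType R).

Definition hilbert_tensor (t : H -> H -> K) : Prop :=
  [/\ forall y, linear (t^~ y), forall x, linear (t x),
      forall x y x' y', hdot (t x y) (t x' y') = hdot x x' * hdot y y'
    & dense (lspan [set t x y | x in setT & y in setT])].

Variable t : H -> H -> K.

(* Y = x ⊗ 1 *)
Definition is_ampl (x : H -> H) (Y : K -> K) : Prop :=
  BH Y /\ forall u v, Y (t u v) = t (x u) v.

(* X = W (x ⊗ 1) W^*, the reduced co-multiplication of the dual *)
Definition is_comul (W : K -> K) (x : H -> H) (X : K -> K) : Prop :=
  exists2 Y, is_ampl x Y & X \o W = W \o Y.

(* y = (id ⊗ w)(X), determined by (y u, v) = (w_{u,v} ⊗ w)(X) for all vectors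
   u, v, where w_{u,v}(T) = (T u, v). For X in the von Neumann tensor product
   of N with itself, this does not depend on the representation of w. *)
Definition is_slice (N : set (H -> H)) (w : (H -> H) -> R[i])
    (X : K -> K) (y : H -> H) : Prop :=
  BH y /\ exists2 p : (nat -> H) * (nat -> H), normal_repr N w p.1 p.2 &
    forall u v, series_to (fun n => hdot (X (t u (p.1 n))) (t v (p.2 n)))
                          (hdot (y u) v).

Definition right_invariant_mean (N : set (H -> H)) (W : K -> K)
    (m : (H -> H) -> R[i]) : Prop :=
  state N m /\
  forall x w X y, N x -> predual N w -> is_comul W x X -> is_slice N w X y ->
    m y = w id * m x.

End HilbertTensor.

Section Dual.
Variables (R : realType) (A : starAlgType R).
Variable Delta : A -> tensor A A -> tensor A A.
Variable phi : {scalar A}.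
Variables (H K : hilbertType R) (Lambda : {linear A -> H}) (t : H -> H -> K).

Definition gns_pair : Prop :=
  dense (range Lambda) /\
  forall a b, hdot (Lambda a) (Lambda b) = phi (b^⋆ ∙ a).

Definition gns_rep (pi : A -> H -> H) : Prop :=
  [/\ forall a, BH (pi a), linear pi,
      forall a b, pi (a ∙ b) = pi a \o pi b,
      forall a, adjoint_pair (pi a) (pi a^⋆)
    & forall a b, pi a (Lambda b) = Lambda (a ∙ b)].

Definition multiplicative_unitary (W : K -> K) : Prop :=
  unitary W /\ forall a b u, is_Delta_l Delta b a u ->
    W (tlift (fun c d => t (Lambda c) (Lambda d)) u) = t (Lambda a) (Lambda b).

Definition dual_elt (a : A) : A -> R[i] := fun b => phi (b ∙ a).
Definition dual : set (A -> R[i]) := range dual_elt.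

(* For w in the dual, the element a with w = a phi; it is unique since phi is
   faithful. *)
Definition dual_coef (w : A -> R[i]) : A := xget 0 [set a | w = dual_elt a].

(* (w1 ⊗ w2) Delta: for w1 = a phi and w2 = b phi, the functional w1 ⊗ w2
   extends to M(A ⊗ A) by x |-> (phi ⊗ phi)(x (a ⊗ b)). *)
Definition dual_mul (w1 w2 : A -> R[i]) : A -> R[i] := fun c =>
  tlift (fun a b => phi a * phi b) (Delta c (dual_coef w1 ⊗ dual_coef w2)).

Definition dual_Lambda (w : A -> R[i]) : H := Lambda (dual_coef w).

Definition dual_rep (pih : (A -> R[i]) -> H -> H) : Prop :=
  forall w, dual w -> BH (pih w) /\
    forall w', dual w' -> pih w (dual_Lambda w') = dual_Lambda (dual_mul w w').

Definition dual_amenable (pih : (A -> R[i]) -> H -> H) (W : K -> K) : Prop :=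
  exists m, right_invariant_mean t (bicommutant (pih @` dual)) W m.

End Dual.

(* Main.v *)
(* Write phi for the Haar trace, Om = Lambda(1), tau(X) = (X Om, Om), and let E
   be a norm-one projection of B(H) onto M. The mean is m = tau o E, restricted
   to the dual von Neumann algebra.

   On M, tau is a trace, because right multiplication by a is bounded on the
   GNS space (phi is tracial) and commutes with pi(A). The main point is that m
   is a hypertrace: m(pi(a) T) = m(T pi(a)) for every T in B(H). Tomiyama's
   theorem is not needed for this. Contractivity of E alone gives the Jordan
   identity E(aT + Ta) = a E(T) + E(T) a for a in M, and therefore
   m(u T u^* ) + m(u^* T u) = 2 m(T) for unitaries u in M. So n |-> m(u^n T u^-n)
   is an arithmetic progression; it is bounded, hence constant. Taking for u the
   Cayley transform of a self-adjoint b = pi(a) yields the claim for b.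

   For c, d in A, the slice of W (x (x) 1) W^* by the vector functional of
   Lambda(c), Lambda(d) is the finite sum of phi(d_2^* c_2) pi(d_1)^* x pi(c_1).
   By the hypertrace property m takes it to m(x pi(a)), where a is the sum of
   phi(c_2 d_2^* ) c_1 d_1^*, which is phi(c d^* ) 1 by left invariance. General
   normal functionals follow by norm approximation. *)

From HB Require Import structures.
Require Import Defs.
From mathcomp Require Import all_boot all_order all_algebra complex.
From mathcomp Require Import all_classical reals topology normedtype sequences.
From mathcomp Require Import ring lra.

Set Implicit Arguments.
Unset Strict Implicit.
Unset Printing Implicit Defensive.

Import Order.TTheory GRing.Theory Num.Theory numFieldNormedType.Exports.

Local Open Scope ring_scope.
Local Open Scope classical_set_scope.

(** * Complex scalars and inner products *)

Notation Re := complex.Re.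
Notation Im := complex.Im.
Notation "x %:C" := (real_complex_def (Phant _) x) : ring_scope.

Section ComplexScalars.
Variable R : realType.
Implicit Types (z w : R[i]) (r : R).

Lemma ReD z w : Re (z + w) = Re z + Re w.
Proof. by case: z w => [a b] [c d]. Qed.

Lemma ImD z w : Im (z + w) = Im z + Im w.
Proof. by case: z w => [a b] [c d]. Qed.

Lemma ReN z : Re (- z) = - Re z.
Proof. by case: z. Qed.

Lemma ImN z : Im (- z) = - Im z.
Proof. by case: z. Qed.

Lemma ReM z w : Re (z * w) = Re z * Re w - Im z * Im w.
Proof. by case: z w => [a b] [c d]. Qed.

Lemma ImM z w : Im (z * w) = Re z * Im w + Im z * Re w.
Proof. by case: z w => [a b] [c d]. Qed.

Lemma ReC r : Re r%:C = r. Proof. by []. Qed.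
Lemma ImC r : Im r%:C = 0. Proof. by []. Qed.

Lemma Re_conj z : Re z^* = Re z.
Proof. by case: z. Qed.

Lemma Im_conj z : Im z^* = - Im z.
Proof. by case: z. Qed.

Lemma Re_i : Re ('i : R[i]) = 0.
Proof. by rewrite -complexiE. Qed.

Lemma Im_i : Im ('i : R[i]) = 1.
Proof. by rewrite -complexiE. Qed.

Lemma complex_ext z w : Re z = Re w -> Im z = Im w -> z = w.
Proof. by case: z w => [a b] [c d] /= -> ->. Qed.

Lemma conjM z w : (z * w)^* = z^* * w^*.
Proof. exact: rmorphM. Qed.

Lemma conj_real r : r%:C^* = r%:C.
Proof. by apply: complex_ext; rewrite ?Re_conj // Im_conj ImC oppr0. Qed.

Definition ReImE := (ReD, ImD, ReN, ImN, ReM, ImM, ReC, ImC, Re_conj, Im_conj,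
  Re_i, Im_i).

Lemma Re_norm2 z : Re `|z| ^+ 2 = Re z ^+ 2 + Im z ^+ 2.
Proof. by rewrite normc_def ReC sqr_sqrtr // addr_ge0 ?sqr_ge0. Qed.

Lemma Re_norm_ge0 z : 0 <= Re `|z|.
Proof. by rewrite normc_def ReC sqrtr_ge0. Qed.

Lemma Re_normM z w : Re `|z * w| = Re `|z| * Re `|w|.
Proof. by rewrite normrM ReM !normc_def !ImC mul0r subr0. Qed.

Lemma Re_normC r : Re `|r%:C| = `|r|.
Proof. by rewrite normc_def !ReImE expr0n addr0 sqrtr_sqr. Qed.

Lemma Re_norm_le0 z : Re `|z| <= 0 -> z = 0.
Proof.
move=> h; have := Re_norm2 z; have := Re_norm_ge0 z => h1 h2.
apply: complex_ext; apply/eqP; rewrite -sqrf_eq0 /=; nra.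
Qed.

Lemma Re_normD z w : Re `|z + w| <= Re `|z| + Re `|w|.
Proof. by have := ler_normD z w; rewrite lecE ReD => /andP[]. Qed.

Lemma abs_Re_le z : `|Re z| <= Re `|z|.
Proof. by have := normc_ge_Re z; rewrite lecE => /andP[]. Qed.

Lemma abs_Im_le z : `|Im z| <= Re `|z|.
Proof.
have := abs_Re_le (z * 'i).
by rewrite Re_normM normCi mulr1 !ReImE mulr0 mulr1 sub0r normrN.
Qed.
End ComplexScalars.

Section InnerProduct.
Variables (R : realType) (H : hilbertType R).
Implicit Types (x y z : H) (k : R[i]).

(** The norm of H takes values in [R[i]]; its real part is the same number in the ordered field R,
    where real arithmetic applies. *)
Definition hn x : R := Re `|x|.

Lemma hnC x : `|x| = (hn x)%:C.
Proof. by apply: complex_ext => //; rewrite ImC; apply: ger0_Im. Qed.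

Lemma hn_ge0 x : 0 <= hn x.
Proof. by have := normr_ge0 x; rewrite hnC ler0c. Qed.

Lemma hn0 : hn 0 = 0. Proof. by rewrite /hn normr0. Qed.

Lemma hnD x y : hn (x + y) <= hn x + hn y.
Proof. by have := ler_normD x y; rewrite !hnC -rmorphD lecR. Qed.

Lemma hnZ k x : hn (k *: x) = Re `|k| * hn x.
Proof. by rewrite /hn normrZ ReM !hnC ImC mulr0 subr0. Qed.

Lemma hnN x : hn (- x) = hn x. Proof. by rewrite /hn normrN. Qed.

Lemma hnBC x y : hn (x - y) = hn (y - x). Proof. by rewrite -hnN opprB. Qed.

Lemma hn_le0 x : hn x <= 0 -> x = 0.
Proof.
move=> h; apply/eqP; rewrite -normr_eq0 hnC; apply/eqP.
by have -> : hn x = 0 by apply/eqP; rewrite eq_le h hn_ge0.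
Qed.

Lemma hdotDl x y z : hdot (x + y) z = hdot x z + hdot y z.
Proof. by have := hdotPl 1 x y z; rewrite scale1r mul1r. Qed.

Lemma hdot0l z : hdot 0 z = 0.
Proof. by apply: (addrI (hdot 0 z)); rewrite -hdotDl !addr0. Qed.

Lemma hdotZl k x z : hdot (k *: x) z = k * hdot x z.
Proof. by have := hdotPl k x 0 z; rewrite hdot0l !addr0. Qed.

Lemma hdotNl x z : hdot (- x) z = - hdot x z.
Proof. by rewrite -scaleN1r hdotZl mulN1r. Qed.

Lemma hdotBl x y z : hdot (x - y) z = hdot x z - hdot y z.
Proof. by rewrite hdotDl hdotNl. Qed.

Lemma hdotDr x y z : hdot x (y + z) = hdot x y + hdot x z.
Proof. by rewrite (hdotC _ x) hdotDl rmorphD /= -!hdotC. Qed.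

Lemma hdotZr k x y : hdot x (k *: y) = k^* * hdot x y.
Proof. by rewrite (hdotC _ x) hdotZl rmorphM /= -hdotC. Qed.

Lemma hdotNr x y : hdot x (- y) = - hdot x y.
Proof. by rewrite (hdotC _ x) hdotNl rmorphN /= -hdotC. Qed.

Lemma hdotBr x y z : hdot x (y - z) = hdot x y - hdot x z.
Proof. by rewrite hdotDr hdotNr. Qed.

Lemma hdot0r x : hdot x 0 = 0.
Proof. by rewrite hdotC hdot0l rmorph0. Qed.

Definition hdotE := (hdotDl, hdotDr, hdotZl, hdotZr, hdotNl, hdotNr).

Lemma hdot_suml I (s : seq I) (F : I -> H) z :
  hdot (\sum_(i <- s) F i) z = \sum_(i <- s) hdot (F i) z.
Proof.
elim: s => [|i s IH]; first by rewrite !big_nil hdot0l.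
by rewrite !big_cons hdotDl IH.
Qed.

Lemma hdot_sumr I (s : seq I) (F : I -> H) z :
  hdot z (\sum_(i <- s) F i) = \sum_(i <- s) hdot z (F i).
Proof.
elim: s => [|i s IH]; first by rewrite !big_nil hdot0r.
by rewrite !big_cons hdotDr IH.
Qed.

Lemma hdotxx x : hdot x x = (hn x ^+ 2)%:C.
Proof. by rewrite hdot_norm hnC -rmorphXn. Qed.

Lemma Re_hdotC x y : Re (hdot x y) = Re (hdot y x).
Proof. by rewrite hdotC Re_conj. Qed.

Lemma Im_hdotC x y : Im (hdot x y) = - Im (hdot y x).
Proof. by rewrite hdotC Im_conj. Qed.

Lemma hnB2 x y : hn (x - y) ^+ 2 = hn x ^+ 2 - 2 * Re (hdot x y) + hn y ^+ 2.
Proof.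
have := hdotxx (x - y); rewrite !(hdotBl, hdotBr) !hdotxx => /(congr1 (@Re R)).
by rewrite !ReImE (Re_hdotC y x) => <-; ring.
Qed.

Lemma hnD2 x y : hn (x + y) ^+ 2 = hn x ^+ 2 + 2 * Re (hdot x y) + hn y ^+ 2.
Proof. by rewrite -[y in LHS]opprK hnB2 hdotNr ReN hnN; ring. Qed.

(** Squaring the triangle inequality for x + y and cancelling the squares leaves exactly this
    bound. *)
Lemma Re_hdot_le x y : Re (hdot x y) <= hn x * hn y.
Proof.
have h := hn_ge0 (x + y); have hx := hn_ge0 x; have hy := hn_ge0 y.
have := hnD x y; have := hnD2 x y; nra.
Qed.

Lemma cauchy_schwarz x y : Re `|hdot x y| <= hn x * hn y.
Proof.
have [->|nz] := eqVneq (hdot x y) 0; first by rewrite normr0 mulr_ge0 ?hn_ge0.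
set z := hdot x y in nz *; set n := Re `|z|.
have n2 : n ^+ 2 = Re z ^+ 2 + Im z ^+ 2 by exact: Re_norm2.
have n0 : 0 < n by rewrite lt_neqAle Re_norm_ge0 andbT; apply: contra nz => /eqP e;
  apply/eqP/Re_norm_le0; rewrite -/n -e.
(* Rotating x by the conjugate of z makes the inner product equal to |z|^2; dividing by |z| gives
   the claim. *)
have := Re_hdot_le (z^* *: x) y.
rewrite hdotZl -/z hnZ ReM Re_conj Im_conj.
rewrite norm_conjC -/n.
nra.
Qed.

Lemma hdot_eq0 x : (forall y, hdot x y = 0) -> x = 0.
Proof.
move=> /(_ x); rewrite hdotxx => /(congr1 (@Re R)); rewrite ReC => /eqP.
by rewrite sqrf_eq0 => /eqP h; apply: hn_le0; rewrite h.
Qed.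

Lemma hdot_ext x x' : (forall y, hdot x y = hdot x' y) -> x = x'.
Proof.
by move=> h; apply/eqP; rewrite -subr_eq0; apply/eqP/hdot_eq0 => y; rewrite hdotBl h subrr.
Qed.

End InnerProduct.

(** * Bounded operators *)

Section BoundedOperators.
Variables (R : realType) (H : hilbertType R).
Implicit Types (x y z : H) (k : R[i]) (S T : H -> H) (C : R).

Definition op_bound C T := forall x, hn (T x) <= C * hn x.

Lemma BH_bound T : BH T -> exists2 C, 0 <= C & op_bound C T.
Proof.
move=> [lT cT]; pose mx := GRing.isLinear.Build _ _ _ _ T lT.
pose f : {linear H -> H} := HB.pack T mx.
have /linear_boundedP/pinfty_ex_gt0[r r0 hr] : bounded_near f (nbhs 0).
  exact/continuous_linear_bounded/cT.
exists (Re r) => [|x]; first by move: r0; rewrite ltcE => /andP[_ /ltW].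
move: (hr x); rewrite !hnC lecE => /andP[_].
by rewrite ReM ImC mulr0 !ReC oppr0 addr0.
Qed.

Lemma bounded_BH T C : linear T -> op_bound C T -> BH T.
Proof.
move=> lT hT; split => //; pose mx := GRing.isLinear.Build _ _ _ _ T lT.
pose f : {linear H -> H} := HB.pack T mx.
apply: (@linear_bounded_continuous _ _ _ f).1; apply/linear_boundedP.
exists C%:C; split; first by apply/complex_realP; exists C.
move=> r Cr x; rewrite !hnC.
have /andP[/eqP Ir Re_r] : (Im r == 0) && (C <= Re r).
  by have := ltW Cr; rewrite lecE ImC.
rewrite lecE !ReImE Ir !(mulr0, mul0r, addr0, subr0) eqxx /=.
by apply: le_trans (hT x) _; rewrite ler_wpM2r ?hn_ge0.
Qed.

Lemma BHD T x y : BH T -> T (x + y) = T x + T y.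
Proof. by case=> lT _; have := lT 1 x y; rewrite !scale1r. Qed.

Lemma BH0 T : BH T -> T 0 = 0.
Proof. by move=> bT; apply: (addrI (T 0)); rewrite -(BHD _ _ bT) !addr0. Qed.

Lemma BHZ T k x : BH T -> T (k *: x) = k *: T x.
Proof. by move=> bT; case: (bT) => lT _; have := lT k x 0; rewrite (BH0 bT) !addr0. Qed.

Lemma BHN T x : BH T -> T (- x) = - T x.
Proof. by move=> bT; rewrite -scaleN1r (BHZ _ _ bT) scaleN1r. Qed.

Lemma BHB T x y : BH T -> T (x - y) = T x - T y.
Proof. by move=> bT; rewrite (BHD _ _ bT) (BHN _ bT). Qed.

Lemma BH_id : BH (id : H -> H).
Proof. by apply: (@bounded_BH _ 1) => [//|x]; rewrite mul1r. Qed.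

Lemma op_boundD C C' S T : op_bound C S -> op_bound C' T -> op_bound (C + C') (S + T).
Proof.
move=> hS hT x; rewrite mulrDl; apply: le_trans (hnD _ _) _.
exact: lerD (hS x) (hT x).
Qed.

Lemma op_boundZ k C T : op_bound C T -> op_bound (Re `|k| * C) (k *: T).
Proof.
by move=> hT x; rewrite [(k *: T) x]/(k *: T x) hnZ -mulrA ler_wpM2l ?Re_norm_ge0.
Qed.

Lemma op_bound_comp C C' S T : 0 <= C ->
  op_bound C S -> op_bound C' T -> op_bound (C * C') (S \o T).
Proof. by move=> C0 hS hT x /=; apply: le_trans (hS _) _; rewrite -mulrA ler_wpM2l. Qed.

Lemma BH_D S T : BH S -> BH T -> BH (S + T).
Proof.
move=> bS bT; have [[C _ hC] [C' _ hC']] := (BH_bound bS, BH_bound bT).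
apply: bounded_BH (op_boundD hC hC') => k x y.
rewrite -![(S + T) _]/(S _ + T _) (bS.1 k x y) (bT.1 k x y) scalerDr.
by rewrite addrACA.
Qed.

Lemma BH_Z k T : BH T -> BH (k *: T).
Proof.
move=> bT; have [C _ hC] := BH_bound bT; apply: bounded_BH (op_boundZ k hC) => l x y.
by rewrite -![(k *: T) _]/(k *: T _) bT.1 scalerDr !scalerA mulrC.
Qed.

Lemma BH_comp S T : BH S -> BH T -> BH (S \o T).
Proof.
move=> bS bT; have [[C C0 hC] [C' _ hC']] := (BH_bound bS, BH_bound bT).
apply: bounded_BH (op_bound_comp C0 hC hC') => k x y /=.
by rewrite bT.1 bS.1.
Qed.

Lemma BH_N T : BH T -> BH (- T).
Proof. by move=> bT; rewrite -scaleN1r; exact: BH_Z. Qed.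

Lemma BH_B S T : BH S -> BH T -> BH (S - T).
Proof. by move=> bS bT; apply/BH_D/BH_N. Qed.

Lemma BH_sum I (s : seq I) (F : I -> H -> H) :
  (forall i, BH (F i)) -> BH (\sum_(i <- s) F i).
Proof.
move=> bF; elim: s => [|i s IH]; last by rewrite big_cons; exact: BH_D.
rewrite big_nil; have -> : 0 = 0 *: (id : H -> H) by rewrite scale0r.
exact/BH_Z/BH_id.
Qed.

Lemma compDr S T T' : BH S -> S \o (T + T') = (S \o T) + (S \o T').
Proof. by move=> bS; apply/funext => x; exact: (BHD (T x) (T' x) bS). Qed.

Lemma compZr k S T : BH S -> S \o (k *: T) = k *: (S \o T).
Proof. by move=> bS; apply/funext => x; exact: (BHZ k (T x) bS). Qed.

Lemma compNr S T : BH S -> S \o (- T) = - (S \o T).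
Proof. by move=> bS; apply/funext => x; exact: (BHN (T x) bS). Qed.

Lemma compDl S S' T : (S + S') \o T = (S \o T) + (S' \o T).
Proof. by []. Qed.

Lemma compZl k S T : (k *: S) \o T = k *: (S \o T).
Proof. by []. Qed.

Lemma compNl S T : (- S) \o T = - (S \o T).
Proof. by []. Qed.

Lemma ballE x y (e : R) : ball x e%:C y = (hn (x - y) < e) :> Prop.
Proof. by rewrite -ball_normE /ball_ /= hnC ltcR. Qed.

Lemma pos_real k : 0 < k -> exists2 e : R, 0 < e & k = e%:C.
Proof.
move=> k0; exists (Re k); first by move: k0; rewrite ltcE => /andP[].
by apply: complex_ext => //; rewrite ImC; apply/ger0_Im/ltW.
Qed.

Lemma dense_hn (X : set H) x (e : R) : dense X -> 0 < e ->
  exists2 y, X y & hn (x - y) < e.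
Proof.
move=> dX e0; have [||y [hy Xy]] := dX (ball x e%:C); last first.
- by exists y => //; rewrite -ballE.
- exact: ball_open.
- by exists x; rewrite ballE subrr hn0.
Qed.

(** Completeness of H for approximate solutions of quality e: points chosen in [P] at 1/(n+1) form a
    Cauchy sequence. It serves both for minimizing sequences and for extension by continuity. *)
Lemma shrinking_limit (P : R -> H -> Prop) :
  (forall e, 0 < e -> exists x, P e x) ->
  (forall e e' x, e <= e' -> P e x -> P e' x) ->
  (forall d, 0 < d -> exists2 e, 0 < e &
     forall x y, P e x -> P e y -> hn (x - y) <= d) ->
  exists x, forall e, 0 < e -> exists2 y, P e y & hn (x - y) < e.
Proof.
move=> P0 Pmono Pdiam.
have [u Pu] : exists u : nat -> H, forall n, P n.+1%:R^-1 (u n).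
  have /choice[u hu] : forall n : nat, exists x, P n.+1%:R^-1 x.
    by move=> n; apply: P0; rewrite invr_gt0 ltr0Sn.
  by exists u.
have inv_small e : 0 < e -> exists M, forall n, (M <= n)%N -> n.+1%:R^-1 <= e :> R.
  move=> e0; exists (Num.trunc e^-1) => n Mn.
  rewrite -[leRHS]invrK lef_pV2 ?posrE ?invr_gt0 ?ltr0Sn //.
  have /ltW := truncnS_gt e^-1; move=> h; apply: le_trans h _.
  by rewrite ler_nat ltnS.
have cu : cauchy (u @ \oo).
  apply/cauchy_ballP => k /pos_real[e e0 ->].
  (* The diameter bound is a weak inequality and balls are strict, hence the half. *)
  have e20 : 0 < e / 2 by rewrite divr_gt0.
  have [e' e'0 he'] := Pdiam _ e20.
  have [M hM] := inv_small _ e'0.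
  exists ([set x | exists2 n, (M <= n)%N & x = u n], [set x | exists2 n, (M <= n)%N & x = u n]).
    by split; exists M => // n /= Mn; exists n.
  move=> [x y] /= [[n Mn ->] [p Mp ->]]; rewrite ballE.
  apply: le_lt_trans (_ : e / 2 < e); last by rewrite ltr_pdivrMr // ltr_pMr // ltr1n.
  by apply: he'; apply: Pmono (Pu _); apply: hM.
have /cauchy_cvg/cvg_ex[l hl] := cu.
exists l => e e0; have [M hM] := inv_small _ e0.
have : \forall n \near \oo, ball l e%:C (u n).
  by move/cvg_ballP : hl => /(_ e%:C); apply; rewrite ltcR.
case=> M' _ hM'; exists (u (maxn M M')).
  by apply: Pmono (Pu _); apply: hM; rewrite leq_maxl.
by have := hM' (maxn M M') (leq_maxr _ _); rewrite /= ballE.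
Qed.

End BoundedOperators.

(** * Riesz representation, adjoints, extension from a dense subspace *)

Section Riesz.
Variables (R : realType) (H : hilbertType R).
Implicit Types (x y v : H) (S T b : H -> H) (C : R).

(** Stands for the passage to the limit e -> 0 that ends the approximation arguments. If a > 0 then
    M > 0, and e = a / (2 M), or e = 1 when that exceeds 1, is contradictory. *)
Lemma le0_of_small (a M : R) : (forall e, 0 < e -> e <= 1 -> a <= e * M) -> a <= 0.
Proof.
move=> h; rewrite leNgt; apply/negP => a0.
have M0 : 0 < M by have := h 1 ltr01 (lexx _); nra.
have h2 : 0 < a / (2 * M) by rewrite divr_gt0 ?mulr_gt0.
have [le1|/ltW gt1] := leP (a / (2 * M)) 1.
  have := h _ h2 le1; suff -> : a / (2 * M) * M = a / 2 by lra.
  by field; apply: lt0r_neq0.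
have := h 1 ltr01 (lexx _); move: gt1; rewrite ler_pdivlMr ?mulr_gt0 //; lra.
Qed.

Lemma le0_of_small0 (a M : R) : (forall e, 0 < e -> a <= e * M) -> a <= 0.
Proof. by move=> h; apply: (@le0_of_small _ M) => e e0 _; exact: h. Qed.

Lemma sqr_le0 (a : R) : a ^+ 2 <= 0 -> a = 0.
Proof. by move=> h; apply/eqP; rewrite -sqrf_eq0 eq_le h sqr_ge0. Qed.

Lemma BH_cst0 : BH (0 : H -> H).
Proof. by have := BH_Z 0 (@BH_id _ H); rewrite scale0r. Qed.

(* The minimizer of |x|^2 + |b x|^2 - 2 Re f(x); b = 0 is the Riesz lemma, and
   for self-adjoint b this inverts 1 + b^2. *)
Lemma perturbed_riesz b (f : H -> R[i]) C : BH b ->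
  (forall k x y, f (k *: x + y) = k * f x + f y) ->
  (forall v, Re `|f v| <= C * hn v) ->
  exists x, forall v, f v = hdot v x + hdot (b v) (b x).
Proof.
move=> bb lf hf; have [B B0 hB] := BH_bound bb.
have f0 : f 0 = 0.
  by apply: (addrI (f 0)); have := lf 1 0 0; rewrite scale1r mul1r !addr0 => <-.
have fD x y : f (x + y) = f x + f y by have := lf 1 x y; rewrite scale1r mul1r.
have fZ k x : f (k *: x) = k * f x by have := lf k x 0; rewrite f0 !addr0.
(* The real quadratic problem is solved for Re f; the imaginary part is recovered at the end by
   testing with i v. *)
pose g v := Re (f v).
pose q x y := Re (hdot x y) + Re (hdot (b x) (b y)).
pose Q x := q x x.
have qC x y : q x y = q y x by rewrite /q Re_hdotC (Re_hdotC (b x)).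
have qDl x y z : q (x + y) z = q x z + q y z.
  by rewrite /q (BHD _ _ bb) !hdotDl !ReD addrACA.
have qZl (t : R) x y : q (t%:C *: x) y = t * q x y.
  by rewrite /q (BHZ _ _ bb) !hdotZl !ReM !ReC !ImC !mul0r !subr0 mulrDr.
have gD x y : g (x + y) = g x + g y by rewrite /g fD ReD.
have gZ (t : R) x : g (t%:C *: x) = t * g x by rewrite /g fZ ReM ReC ImC mul0r subr0.
have QE x : Q x = hn x ^+ 2 + hn (b x) ^+ 2 by rewrite /Q /q !hdotxx !ReC.
have QD x y (t : R) : Q (x + t%:C *: y) = Q x + 2 * t * q x y + t ^+ 2 * Q y.
  rewrite /Q qDl (qC x (x + _)) (qC (_ *: y)) !qDl !qZl (qC x (_ *: _)).
  by rewrite (qC y (_ *: _)) !qZl (qC y x); ring.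
pose Phi x := Q x - 2 * g x.
have PhiD x y (t : R) :
    Phi (x + t%:C *: y) = Phi x + 2 * t * (q x y - g y) + t ^+ 2 * Q y.
  by rewrite /Phi QD gD gZ; ring.
have gle x : `|g x| <= C * hn x by apply: le_trans (abs_Re_le _) (hf x).
have Q0 x : 0 <= Q x by rewrite QE addr_ge0 ?sqr_ge0.
have Phi_lb x : - C ^+ 2 <= Phi x.
  have := gle x; rewrite ler_norml => /andP[_ h].
  have h1 : hn x ^+ 2 <= Q x by rewrite QE lerDl sqr_ge0.
  by have := sqr_ge0 (hn x - C); rewrite /Phi; nra.
have infP : has_inf (range Phi).
  by split; [exists (Phi 0), 0 | exists (- C ^+ 2) => _ [x _ <-]].
pose d := inf (range Phi).
have dle x : d <= Phi x by apply: ge_inf; [exact: infP.2 | exists x].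
pose P e x := Phi x <= d + e.
(* At a point within e of the infimum, the quadratic polynomial h(t) is nonnegative for all t, so
   its discriminant is controlled. Using Q v + 1 as leading coefficient keeps the minimizing t
   defined when Q v = 0. *)
have first_order e y v : 0 < e -> P e y -> (q y v - g v) ^+ 2 <= e * (Q v + 1).
  move=> e0 Pe; set L := q y v - g v.
  have Q1 : 0 < Q v + 1 by have := Q0 v; lra.
  have h t : 0 <= t ^+ 2 * (Q v + 1) + 2 * t * L + e.
    by have := dle (y + t%:C *: v); rewrite PhiD -/L; move: Pe; rewrite /P;
      have := sqr_ge0 t; nra.
  have := h (- L / (Q v + 1)).
  have -> : (- L / (Q v + 1)) ^+ 2 * (Q v + 1) + 2 * (- L / (Q v + 1)) * L + e
    = (e * (Q v + 1) - L ^+ 2) / (Q v + 1) by field; apply: lt0r_neq0.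
  by rewrite pmulr_lge0 ?invr_gt0 // subr_ge0.
have [|e e' x ee' Pe|r r0|x hx] := @shrinking_limit _ H P.
- by move=> e e0; have [_ [x _ <-] /ltW] := inf_adherent e0 infP; exists x.
- by apply: le_trans Pe _; rewrite lerD2l.
(* Parallelogram law: Phi at the midpoint is the mean of Phi x and Phi y minus Q(x - y)/4, and it is
   at least d. Values up to d + r^2/4 therefore give Q(x - y) <= r^2. *)
- exists (r ^+ 2 / 4) => [|x y]; first by rewrite divr_gt0 ?exprn_gt0.
  rewrite /P => Px Py.
  have mid := dle (x + (- 2^-1)%:C *: (x - y)).
  have e1 : y = x + (-1)%:C *: (x - y).
    by rewrite rmorphN1 scaleN1r opprB addrC subrK.
  have hy : Phi y = Phi x + 2 * (-1) * (q x (x - y) - g (x - y)) + (-1) ^+ 2 * Q (x - y).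
    by rewrite [in LHS]e1 PhiD.
  move: mid; rewrite PhiD => mid.
  have h4 : Q (x - y) <= r ^+ 2 by lra.
  have : hn (x - y) ^+ 2 <= r ^+ 2 by apply: le_trans h4; rewrite QE lerDl sqr_ge0.
  by rewrite ler_pXn2r // nnegrE ?hn_ge0 ?ltW.
exists x.
have key v : g v = q v x.
  apply/eqP; rewrite eq_sym qC -subr_eq0; apply/eqP/sqr_le0.
  (* The constant comes from (s + t)^2 <= 2 s^2 + 2 t^2, applied to the first-order error at y and
     to q(x - y, v), with e^2 <= e in the second term. *)
  apply: (@le0_of_small _ (2 * (Q v + 1) + 2 * ((1 + B ^+ 2) * hn v) ^+ 2)) => e e0 e1.
  have [y Py hxy] := hx e e0; have fo := first_order e y v e0 Py.
  have hL : q x v - g v = (q y v - g v) + q (x - y) v.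
    by have := qDl (x - y) y v; rewrite subrK => ->; ring.
  have hq : `|q (x - y) v| <= e * ((1 + B ^+ 2) * hn v).
    have h1 : `|Re (hdot (x - y) v)| <= hn (x - y) * hn v.
      exact: le_trans (abs_Re_le _) (cauchy_schwarz _ _).
    have h2 : `|Re (hdot (b (x - y)) (b v))| <= hn (b (x - y)) * hn (b v).
      exact: le_trans (abs_Re_le _) (cauchy_schwarz _ _).
    have h3 : hn (b (x - y)) * hn (b v) <= (B * hn (x - y)) * (B * hn v).
      by rewrite ler_pM ?hn_ge0.
    have h4 : hn (x - y) * ((1 + B ^+ 2) * hn v) <= e * ((1 + B ^+ 2) * hn v).
      rewrite ler_wpM2r ?(ltW hxy) // mulr_ge0 ?hn_ge0 //.
      by rewrite addr_ge0 ?sqr_ge0.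
    rewrite /q; apply: le_trans (ler_normD _ _) _.
    move: h1 h2 h3 h4; set p1 := `|_|; set p2 := `|_|; lra.
  have hq2 : q (x - y) v ^+ 2 <= e ^+ 2 * ((1 + B ^+ 2) * hn v) ^+ 2.
    by rewrite -exprMn -[leLHS]real_normK ?num_real // ler_pXn2r // nnegrE
      ?normr_ge0 ?(le_trans (normr_ge0 _) hq).
  have he2 : e ^+ 2 * ((1 + B ^+ 2) * hn v) ^+ 2 <= e * ((1 + B ^+ 2) * hn v) ^+ 2.
    by rewrite ler_wpM2r ?sqr_ge0 // expr2 ler_piMr // ltW.
  have := sqr_ge0 (q y v - g v - q (x - y) v).
  rewrite hL; nra.
move=> v; apply: complex_ext; first by rewrite ReD; exact: key.
have := key ('i *: v); rewrite /g /q fZ (BHZ _ _ bb) !hdotZl !ReM Re_i Im_i ImD.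
lra.
Qed.

(** For fixed u the conjugate of B u v is linear in v, so the Riesz lemma (the case b = 0)
    represents it by a vector T u. Both adjoints and slices are obtained this way. *)
Lemma sesquilinear_op (B : H -> H -> R[i]) C :
  (forall k u u' v, B (k *: u + u') v = k * B u v + B u' v) ->
  (forall k u v v', B u (k *: v + v') = k^* * B u v + B u v') ->
  (forall u v, Re `|B u v| <= C * hn u * hn v) ->
  exists T, [/\ BH T, op_bound C T & forall u v, hdot (T u) v = B u v].
Proof.
move=> Bl Br hB.
have /choice[T hT] : forall u, exists x, forall v, (B u v)^* = hdot v x.
  move=> u.
  have [|v|x hx] := @perturbed_riesz 0 (fun v => (B u v)^*) (C * hn u) BH_cst0.
  - by move=> k x y; rewrite Br rmorphD rmorphM /= conjCK.
  - by rewrite norm_conjC.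
  - by exists x => v; rewrite hx -[(0 : H -> H) _]/(0 : H) hdot0l addr0.
have TE u v : hdot (T u) v = B u v by rewrite hdotC -hT conjCK.
have bT : op_bound C T.
  move=> u; have h : hn (T u) ^+ 2 <= C * hn u * hn (T u).
    rewrite -[leLHS]ReC -hdotxx TE; apply: le_trans (hB u (T u)).
    exact: le_trans (ler_norm _) (abs_Re_le _).
  have [e|ne] := eqVneq (hn (T u)) 0.
    rewrite e; have := hB u u; have := Re_norm_ge0 (B u u).
    have [e'|] := eqVneq (hn u) 0; first by move=> _ _; rewrite e' mulr0.
    move=> ne; have p : 0 < hn u by rewrite lt_neqAle eq_sym ne hn_ge0.
    by move=> h1 h2; have := le_trans h1 h2; rewrite pmulr_lge0.
  have p : 0 < hn (T u) by rewrite lt_neqAle eq_sym ne hn_ge0.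
  by move: h; rewrite expr2 ler_pM2r.
exists T; split=> //; apply: bounded_BH bT => k x y.
by apply: hdot_ext => z; rewrite hdotPl !TE Bl.
Qed.

Lemma adjoint_exists T : BH T -> exists2 S, BH S & adjoint_pair T S.
Proof.
move=> bT; have [C C0 hC] := BH_bound bT.
have [|k u v v'|u v|S [bS _ hS]] :=
  @sesquilinear_op (fun u v => hdot u (T v)) C.
- by move=> k u u' v; rewrite hdotPl.
- by rewrite (bT.1 k v v') hdotDr hdotZr.
- apply: le_trans (cauchy_schwarz _ _) _; rewrite mulrC mulrAC.
  by rewrite ler_wpM2r ?hn_ge0.
- by exists S => // x y; rewrite hdotC [RHS]hdotC hS.
Qed.

Lemma adjoint_sym T S : adjoint_pair T S -> adjoint_pair S T.
Proof. by move=> h x y; rewrite hdotC -h -hdotC. Qed.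

Lemma adjoint_BH T S : BH T -> adjoint_pair T S -> BH S.
Proof.
move=> /adjoint_exists[S' bS' h'] h; suff -> : S = S' by [].
by apply/funext => x; apply: hdot_ext => y; rewrite hdotC -h h' -hdotC.
Qed.

Lemma adjoint_bound T S C : 0 <= C -> op_bound C T -> adjoint_pair T S -> op_bound C S.
Proof.
move=> C0 hT h x; have h1 : hn (S x) ^+ 2 <= C * hn (S x) * hn x.
  rewrite -[leLHS]ReC -hdotxx -h; apply: le_trans (Re_hdot_le _ _) _.
  by rewrite ler_wpM2r ?hn_ge0.
have [->|ne] := eqVneq (hn (S x)) 0; first by rewrite mulr_ge0 ?hn_ge0.
have p : 0 < hn (S x) by rewrite lt_neqAle eq_sym ne hn_ge0.
by move: h1; rewrite expr2 mulrAC ler_pM2r.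
Qed.

(** Representing v |-> (v, y) by the form (v, x) + (b v, b x) solves x + b (b x) = y. Coercivity of
    1 + b^2 makes the solution unique and s a contraction. This resolvent is the ingredient of the
    Cayley transform. *)
Lemma inverse_one_plus_sqr b : BH b -> adjoint_pair b b ->
  exists s, [/\ BH s, adjoint_pair s s, forall x, s x + b (b (s x)) = x
    & forall x, s (x + b (b x)) = x].
Proof.
move=> bb ab.
have /choice[s hs] : forall y, exists x, x + b (b x) = y.
  move=> y; have [|v|x hx] := @perturbed_riesz b (fun v => hdot v y) (hn y) bb.
  - by move=> k u v; rewrite hdotPl.
  - by rewrite mulrC cauchy_schwarz.
  - exists x; apply: hdot_ext => v; rewrite hdotC [RHS]hdotC hx.
    by rewrite hdotDr ab.
have coer x : hn x ^+ 2 <= Re (hdot x (x + b (b x))).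
  by rewrite hdotDr -ab !hdotxx ReD !ReC lerDl sqr_ge0.
have inj x y : x + b (b x) = y + b (b y) -> x = y.
  move=> e; apply/eqP; rewrite -subr_eq0; apply/eqP/hn_le0.
  suff -> : hn (x - y) = 0 by [].
  apply: sqr_le0; apply: le_trans (coer _) _.
  by rewrite !(BHB _ _ bb) addrACA -opprD e subrr hdot0r.
have ls : linear s.
  move=> k x y; apply: inj; rewrite hs !(BHD _ _ bb) !(BHZ _ _ bb) addrACA -scalerDr.
  by rewrite !hs.
have bs : BH s.
  apply: (@bounded_BH _ _ s 1 ls) => x; rewrite mul1r.
  have h := le_trans (coer (s x)) (Re_hdot_le _ _); move: h; rewrite hs.
  have [->|ne] := eqVneq (hn (s x)) 0; first by rewrite hn_ge0.
  by rewrite expr2 ler_pM2l // lt_neqAle eq_sym ne hn_ge0.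
exists s; split=> // [x y|x]; last by apply: inj; rewrite hs.
by rewrite -{1}(hs y) -{2}(hs x) !(hdotDl, hdotDr) -!ab.
Qed.

Lemma dense_extension (A : lmodType R[i]) (L : {linear A -> H}) (f : A -> H) C :
  0 <= C -> dense (range L) -> linear f -> (forall a, hn (f a) <= C * hn (L a)) ->
  exists2 T, BH T & forall a, T (L a) = f a.
Proof.
move=> C0 dL lf hf.
have f0 : f 0 = 0.
  by apply: (addrI (f 0)); have := lf 1 0 0; rewrite !scale1r !addr0 => <-.
have fB a a' : f (a - a') = f a - f a'.
  by have := lf (-1) a' a; rewrite !scaleN1r [- a' + a]addrC [- f a' + f a]addrC.
(* G is the closure of the graph of L a |-> f a. The bound on f makes it single-valued, even when L
   is not injective. *)
pose G x y := forall e : R, 0 < e -> exists2 a, hn (x - L a) < e & hn (y - f a) < e.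
have Gex x : exists y, G x y.
  have [e e0|e e' y ee' [a xa ->]|d d0|y hy] :=
    @shrinking_limit _ H (fun e y => exists2 a, hn (x - L a) < e & y = f a).
  - by have [_ [a _ <-] xa] := dense_hn x dL e0; exists (f a), a.
  - by exists a => //; apply: lt_le_trans xa ee'.
  (* Two approximants of x have L-images less than 2 e apart, so their f-images are at most 2 C e
     apart; C + 1 keeps the quotient defined for C = 0. *)
  - exists (d / (2 * (C + 1))) => [|_ _ [a xa ->] [a' xa' ->]].
      by rewrite divr_gt0 // mulr_gt0 //; lra.
    rewrite -fB; apply: le_trans (hf _) _.
    have h : hn (L (a - a')) <= hn (x - L a) + hn (x - L a').
      rewrite linearB /= (hnBC x (L a)); apply: le_trans (hnD _ _).
      by rewrite addrA subrK.
    have p : 0 < 2 * (C + 1) by apply: mulr_gt0 => //; lra.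
    move: xa xa'; rewrite !ltr_pdivlMr // => xa xa'.
    have C1 : 0 <= C + 1 by lra.
    by have := ler_wpM2l C1 h; have := hn_ge0 (L (a - a')); lra.
  - exists y => e e0; have [_ [a xa ->] ya] := hy e e0.
    by exists a.
have Guniq x y y' : G x y -> G x y' -> y = y'.
  move=> h h'; apply/eqP; rewrite -subr_eq0; apply/eqP/hn_le0.
  apply: (@le0_of_small0 _ (2 * C + 2)) => e e0.
  have [[a xa ya] [a' xa' ya']] := (h e e0, h' e e0).
  have h1 : hn (y - y') <= hn (y - f a) + hn (f (a - a')) + hn (y' - f a').
    rewrite fB (hnBC y'); apply: le_trans (lerD (hnD _ _) (lexx _)).
    by apply: le_trans (hnD _ _); rewrite !addrA !subrK.
  have h2 : hn (L (a - a')) <= hn (x - L a) + hn (x - L a').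
    rewrite linearB /= (hnBC x (L a)); apply: le_trans (hnD _ _).
    by rewrite addrA subrK.
  have := hf (a - a'); nra.
have [T hT] := choice Gex.
have GL a : G (L a) (f a) by move=> e e0; exists a; rewrite subrr hn0.
have GE k x y x' y' : G x y -> G x' y' -> G (k *: x + x') (k *: y + y').
  move=> h h' e e0.
  pose e' := e / (Re `|k| + 1).
  have k0 := Re_norm_ge0 k.
  have p : 0 < Re `|k| + 1 by lra.
  have e'0 : 0 < e' by rewrite divr_gt0.
  have [[a xa ya] [a' xa' ya']] := (h e' e'0, h' e' e'0).
  have ee : e = Re `|k| * e' + e' by rewrite /e'; field; exact: lt0r_neq0.
  exists (k *: a + a').
    rewrite linearP /= opprD addrACA -scalerBr; apply: le_lt_trans (hnD _ _) _.
    by rewrite hnZ ee; nra.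
  rewrite lf opprD addrACA -scalerBr; apply: le_lt_trans (hnD _ _) _.
  by rewrite hnZ ee; nra.
exists T => [|a]; last exact: Guniq (hT _) (GL a).
apply: (@bounded_BH _ _ T C) => [k x y|x]; first exact: Guniq (hT _) (GE _ _ _ _ _ _ _).
rewrite -subr_le0; apply: (@le0_of_small0 _ (C + 1)) => e e0.
have [a xa ya] := hT x e e0.
have h1 : hn (T x) <= hn (T x - f a) + hn (f a).
  by apply: le_trans (hnD _ _); rewrite subrK.
have h2 : hn (L a) <= hn (x - L a) + hn x.
  by rewrite (hnBC x); apply: le_trans (hnD _ _); rewrite subrK.
have := hf a; nra.
Qed.

Lemma dense_BH_eq (X : set H) S T : dense X -> BH S -> BH T ->
  (forall x, X x -> S x = T x) -> S = T.
Proof.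
move=> dX bS bT h; have [[C C0 hC] [C' C'0 hC']] := (BH_bound bS, BH_bound bT).
apply/funext => x; apply/eqP; rewrite -subr_eq0; apply/eqP/hn_le0.
apply: (@le0_of_small0 _ (C + C')) => e e0.
have [y Xy xy] := dense_hn x dX e0.
have -> : S x - T x = S (x - y) - T (x - y).
  by rewrite (BHB _ _ bS) (BHB _ _ bT) (h _ Xy) opprB addrA subrK.
apply: le_trans (hnD _ _) _; rewrite hnN.
by have := hC (x - y); have := hC' (x - y); nra.
Qed.

End Riesz.

(** * Commutants, quadratic forms, operator norm *)

Section Commutant.
Variables (R : realType) (H : hilbertType R) (Y : set (H -> H)).
Hypothesis bY : Y `<=` @BH R H.
Implicit Types (S T : H -> H).

Lemma commutant_BH T : commutant Y T -> BH T. Proof. by case. Qed.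

Lemma commutant_id : commutant Y id.
Proof. by split; [exact: BH_id | move=> S _; apply/funext]. Qed.

Lemma commutantD S T : commutant Y S -> commutant Y T -> commutant Y (S + T).
Proof.
move=> [bS cS] [bT cT]; split; first exact: BH_D.
by move=> U YU; rewrite compDl compDr ?cS ?cT //; exact: bY.
Qed.

Lemma commutantZ k T : commutant Y T -> commutant Y (k *: T).
Proof.
move=> [bT cT]; split; first exact: BH_Z.
by move=> U YU; rewrite compZl compZr ?cT //; exact: bY.
Qed.

Lemma commutantB S T : commutant Y S -> commutant Y T -> commutant Y (S - T).
Proof. by move=> cS cT; rewrite -scaleN1r; apply/commutantD/commutantZ. Qed.

Lemma commutant_comp S T : commutant Y S -> commutant Y T -> commutant Y (S \o T).
Proof.
move=> [bS cS] [bT cT]; split; first exact: BH_comp.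
by move=> U YU; rewrite -compA cT // compA cS.
Qed.

End Commutant.

Section QuadraticForm.
Variables (R : realType) (H : hilbertType R).
Implicit Types (x y : H) (S T h b : H -> H).

Lemma selfadjoint_Im T x : adjoint_pair T T -> Im (hdot (T x) x) = 0.
Proof. by move=> aT; have := Im_hdotC (T x) x; rewrite -aT; lra. Qed.

(** Complex polarization: x + y and x + i y give the sum and the difference of (T x, y) and (T y,
    x). *)
Lemma quadratic_eq0 T : BH T -> (forall x, hdot (T x) x = 0) -> T = 0.
Proof.
move=> bT q; apply/funext => x; apply: hdot_eq0 => y.
have h1 : hdot (T x) y + hdot (T y) x = 0.
  have := q (x + y); rewrite (BHD _ _ bT) !(hdotDl, hdotDr) !q add0r addr0.
  by [].
have := q (x + 'i *: y).
rewrite (BHD _ _ bT) (BHZ _ _ bT) !(hdotDl, hdotDr) !(hdotZl, hdotZr) !q.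
rewrite conjCi !mulr0 add0r addr0 mulNr addrC => /eqP; rewrite subr_eq0.
move=> /eqP/(mulfI (neq0Ci _)) h2; move: h1; rewrite h2 -mulr2n => /eqP.
by rewrite mulrn_eq0 /= => /eqP.
Qed.

Lemma adjointD S S' T T' : adjoint_pair S S' -> adjoint_pair T T' ->
  adjoint_pair (S + T) (S' + T').
Proof.
move=> hS hT x y; rewrite -[(S + T) x]/(S x + T x) -[(S' + T') y]/(S' y + T' y).
by rewrite hdotDl hdotDr hS hT.
Qed.

Lemma adjointZ k T T' : adjoint_pair T T' -> adjoint_pair (k *: T) (k^* *: T').
Proof.
move=> hT x y; rewrite -[(k *: T) x]/(k *: T x) -[(_ *: T') y]/(_ *: T' y).
by rewrite hdotZl hdotZr conjCK hT.
Qed.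

Lemma adjoint_comp S S' T T' : adjoint_pair S S' -> adjoint_pair T T' ->
  adjoint_pair (S \o T) (T' \o S').
Proof. by move=> hS hT x y /=; rewrite hS hT. Qed.

(** The quadratic form of T minus its adjoint is 2 i Im (T x, x), and over the complex numbers the
    form determines the operator. *)
Lemma selfadjoint_of_Im T : BH T -> (forall x, Im (hdot (T x) x) = 0) ->
  adjoint_pair T T.
Proof.
move=> bT q; have [S bS aS] := adjoint_exists bT.
suff e : T - S = 0 by move/eqP: e; rewrite subr_eq0 => /eqP e; rewrite {2}e.
apply: quadratic_eq0; first exact: BH_B.
move=> x; rewrite -[(T - S) x]/(T x - S x) hdotBl (adjoint_sym aS) (hdotC (T x)).
by apply: complex_ext; rewrite !ReImE ?q; ring.
Qed.

Lemma half_double (V : lmodType R[i]) (v : V) : 2^-1 *: (v + v) = v.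
Proof.
by rewrite -{1 2}[v]scale1r -scalerDl scalerA mulVf ?scale1r // pnatr_eq0.
Qed.

(** Cartesian parts of T when S is its adjoint; S is an argument because adjoints are treated as a
    relation. *)
Definition re_part S T : H -> H := 2^-1 *: (T + S).
Definition im_part S T : H -> H := (- 'i / 2) *: (T - S).

Lemma re_im_part S T : T = re_part S T + 'i *: im_part S T.
Proof.
rewrite /re_part /im_part scalerA.
have -> : 'i * (- 'i / 2) = 2^-1 :> R[i] by rewrite mulrA mulrN -expr2 sqrCi opprK mul1r.
by rewrite -scalerDr addrACA subrr addr0 half_double.
Qed.

Lemma re_im_part_adj S T : S = re_part S T - 'i *: im_part S T.
Proof.
rewrite /re_part /im_part scalerA.
have -> : 'i * (- 'i / 2) = 2^-1 :> R[i] by rewrite mulrA mulrN -expr2 sqrCi opprK mul1r.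
by rewrite -scalerBr opprB (addrC T) addrACA subrr addr0 half_double.
Qed.

Lemma re_part_adj S T : adjoint_pair T S -> adjoint_pair (re_part S T) (re_part S T).
Proof.
move=> a; have := adjointZ 2^-1 (adjointD a (adjoint_sym a)).
by rewrite addrC fmorphV rmorph_nat /re_part [S + T]addrC.
Qed.

Lemma im_part_adj S T : adjoint_pair T S -> adjoint_pair (im_part S T) (im_part S T).
Proof.
move=> a; have := adjointZ (- 'i / 2) (adjointD a (adjointZ (-1) (adjoint_sym a))).
have -> : (- 'i / 2 : R[i])^* = - (- 'i / 2).
  by rewrite rmorphM fmorphV rmorph_nat rmorphN /= conjCi opprK mulNr opprK.
by rewrite rmorphN1 !scaleN1r scaleNr -scalerN opprB.
Qed.

End QuadraticForm.

(** On (0, 1] the powers above s^2 are at most s^2, so c0 + c1 s is itself O(s^2). Letting s -> 0,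
    before and after division by s, kills both coefficients. It extracts the first-order content of
    contractivity. *)
Lemma quadratic_small (R : realType) (c0 c1 c2 c3 c4 K : R) :
  (forall s : R, 0 < s -> s <= 1 ->
     `|c0 + c1 * s + c2 * s ^+ 2 + c3 * s ^+ 3 + c4 * s ^+ 4| <= K * s ^+ 2) ->
  c0 = 0 /\ c1 = 0.
Proof.
move=> h; pose M : R := `|c2| + `|c3| + `|c4| + K.
have hc (c : R) j (s : R) : 0 < s -> s <= 1 -> `|c * s ^+ j.+2| <= `|c| * s ^+ 2.
  move=> s0 s1; rewrite normrM; apply: ler_wpM2l => //.
  rewrite ger0_norm; last by rewrite exprn_ge0 ?ltW.
  have -> : s ^+ j.+2 = s ^+ j * s ^+ 2 by rewrite -exprD addn2.
  by apply: ler_piMl; [exact/exprn_ge0/ltW | apply: exprn_ile1 => //; exact: ltW].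
have key (s : R) : 0 < s -> s <= 1 -> `|c0 + c1 * s| <= M * s ^+ 2.
  move=> s0 s1; have := h s s0 s1.
  have := hc c2 0%N s s0 s1; have := hc c3 1%N s s0 s1; have := hc c4 2%N s s0 s1.
  rewrite /M !mulrDl; move: (c2 * _) (c3 * _) (c4 * _) (`|c2| * _) (`|c3| * _) (`|c4| * _).
  move=> a2 a3 a4 b2 b3 b4; rewrite !ler_norml.
  by move=> /andP[? ?] /andP[? ?] /andP[? ?] /andP[? ?]; apply/andP; split; lra.
have M0 : 0 <= M.
  by have := key 1 ltr01 (lexx _); rewrite expr1n !mulr1; exact/le_trans/normr_ge0.
have c00 : c0 = 0.
  apply/eqP; rewrite -normr_le0; apply/(@le0_of_small _ _ (M + `|c1|)) => s s0 s1.
  have := key s s0 s1; have := ler_normB (c0 + c1 * s) (c1 * s).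
  rewrite addrK normrM (gtr0_norm s0); have : M * s ^+ 2 <= M * s.
    by rewrite ler_wpM2l // expr2 ler_piMl // ltW.
  lra.
split=> //; apply/eqP; rewrite -normr_le0; apply/(@le0_of_small _ _ M) => s s0 s1.
have := key s s0 s1; rewrite c00 add0r normrM (gtr0_norm s0) expr2 mulrA ler_pM2r //.
by rewrite mulrC.
Qed.

Section Opnorm.
Variables (R : realType) (H : hilbertType R).
Implicit Types (S T : H -> H) (C : R).

Lemma opnorm_le C T : BH T -> op_bound C T -> 0 <= C -> opnorm T <= C.
Proof.
move=> bT hC C0; apply: ge_sup.
  by exists (hn (T 0)), 0 => //=; rewrite normr0 ler01.
move=> _ [x /= x1 <-]; apply: le_trans (hC x) _; rewrite ler_piMr //.
by move: x1; rewrite hnC lecE => /andP[].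
Qed.

Lemma op_bound_opnorm T : BH T -> op_bound (opnorm T) T.
Proof.
move=> bT x; have [C C0 hC] := BH_bound bT.
have [e|ne] := eqVneq (hn x) 0.
  have -> : x = 0 by apply: hn_le0; rewrite e.
  by rewrite (BH0 bT) hn0 mulr0.
have p : 0 < hn x by rewrite lt_neqAle eq_sym ne hn_ge0.
rewrite -ler_pdivrMr //; apply: ub_le_sup.
  exists C => _ [y /= y1 <-]; apply: le_trans (hC y) _; rewrite ler_piMr //.
  by move: y1; rewrite hnC lecE => /andP[].
have nV : Re `|((hn x)^-1)%:C| = (hn x)^-1.
  by rewrite Re_normC ger0_norm // invr_ge0 hn_ge0.
exists (((hn x)^-1)%:C *: x) => /=; last first.
  by rewrite (BHZ _ _ bT) -/(hn _) hnZ nV mulrC.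
by rewrite hnC hnZ nV mulVf // lexx.
Qed.

End Opnorm.

(** * Norm-one projections *)

Section ContractiveProjection.
Variables (R : realType) (H : hilbertType R) (Y : set (H -> H)).
Variable E : (H -> H) -> (H -> H).
Hypothesis bY : Y `<=` @BH R H.
(** The algebra is presented as a commutant, which gives its closure under sums and products. In the
    application Y is the commutant of pi(A). *)
Let N := commutant Y.
Hypothesis E_lin : forall (k : R[i]) S T, BH S -> BH T -> E (k *: S + T) = k *: E S + E T.
Hypothesis E_in : forall T, BH T -> N (E T).
Hypothesis E_fix : forall T, N T -> E T = T.
Hypothesis E_contr : forall T C, 0 <= C -> BH T -> op_bound C T -> op_bound C (E T).
Implicit Types (x y : H) (S T h b : H -> H).

Let NBH T : N T -> BH T. Proof. exact: commutant_BH. Qed.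
Let E_BH T : BH T -> BH (E T). Proof. by move/E_in/NBH. Qed.

Lemma cexp0 : E 0 = 0.
Proof. by apply: E_fix; have := commutantZ bY 0 (commutant_id Y); rewrite scale0r. Qed.

Lemma cexpD S T : BH S -> BH T -> E (S + T) = E S + E T.
Proof. by move=> bS bT; have := E_lin 1 bS bT; rewrite !scale1r. Qed.

Lemma cexpZ k T : BH T -> E (k *: T) = k *: E T.
Proof. by move=> bT; have := E_lin k bT (BH_cst0 H); rewrite cexp0 !addr0. Qed.

Lemma cexpB S T : BH S -> BH T -> E (S - T) = E S - E T.
Proof.
move=> bS bT; rewrite cexpD //; last exact: BH_N.
by rewrite -[- T]scaleN1r cexpZ // scaleN1r.
Qed.

(* Contractivity of [E] is tested on [w (h + i k)] with [w = 1 + i s b - s^2 b^2 / 2],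
   which is unitary up to order [s^4], and with [k = ± s^-2]. *)
Lemma cexp_selfadjoint h b x : BH h -> adjoint_pair h h -> N b -> adjoint_pair b b ->
  Im (hdot (E h x) x) = 0 /\ Re (hdot (E (b \o h) x) x) = Re (hdot (E h x) (b x)).
Proof.
move=> bh ah Nb ab; have bb := NBH Nb.
have [x0|xn0] := eqVneq (hn x) 0.
  have -> : x = 0 by apply: hn_le0; rewrite x0.
  by rewrite (BH0 bb) !hdot0r.
have X0 : 0 < hn x ^+ 2 by rewrite exprn_gt0 // lt_neqAle eq_sym xn0 hn_ge0.
have [[B B0 hB] [C C0 hC]] := (BH_bound bb, BH_bound bh).
pose z (s : R) : R[i] := 'i * s%:C.
pose z2 (s : R) : R[i] := (- (s ^+ 2) / 2)%:C.
pose w s : H -> H := id + (z s *: b + z2 s *: (b \o b)).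
have bbb : BH (b \o b) by exact: BH_comp.
have wE s u : w s u = u + (z s *: b u + z2 s *: b (b u)) by [].
have Nw s : N (w s).
  apply: commutantD => //; first exact: commutant_id.
  by apply: commutantD => //; apply: commutantZ => //; exact: commutant_comp.
pose kap := B ^+ 4 / 4.
have kap0 : 0 <= kap by rewrite divr_ge0 ?exprn_ge0.
(* For self-adjoint b the product w^* w is (1 - s^2 b^2 / 2)^2 + s^2 b^2 = 1 + s^4 b^4 / 4; hence
   also the constant [kap]. *)
have wn s u : hn (w s u) ^+ 2 = hn u ^+ 2 + s ^+ 4 / 4 * hn (b (b u)) ^+ 2.
  rewrite -[LHS]ReC -hdotxx wE.
  have e1 := selfadjoint_Im u ab; have e2 := selfadjoint_Im (b u) ab.
  have e3 : hdot (b (b u)) u = (hn (b u) ^+ 2)%:C by rewrite ab hdotxx.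
  have e4 : hdot u (b (b u)) = (hn (b u) ^+ 2)%:C by rewrite -ab hdotxx.
  have e5 := Im_hdotC u (b u); have e6 := Im_hdotC (b u) (b (b u)).
  rewrite /z /z2; set c := - (s ^+ 2) / 2; have cE : c = - (s ^+ 2) / 2 by [].
  move: c cE => c cE.
  rewrite !(hdotDl, hdotDr) !(hdotZl, hdotZr) !hdotxx e3 e4 !(conjM, conj_real, conjCi).
  move: (hn u ^+ 2) (hn (b u) ^+ 2) (hn (b (b u)) ^+ 2) => a0 a1 a2.
  rewrite !ReImE e5 e6 e1 e2 !(mulr0, mul0r, subr0, sub0r, addr0, add0r, mulr1, mul1r, oppr0).
  by rewrite cE; field.
have wle s u : hn (w s u) ^+ 2 <= (1 + kap * s ^+ 4) * hn u ^+ 2.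
  rewrite wn mulrDl mul1r lerD2l.
  have h1 : hn (b (b u)) <= B * (B * hn u).
    by apply: le_trans (hB _) _; rewrite ler_wpM2l.
  have h2 : hn (b (b u)) ^+ 2 <= (B * (B * hn u)) ^+ 2.
    by rewrite ler_pXn2r // nnegrE ?hn_ge0 // !mulr_ge0 ?hn_ge0.
  have s0 : 0 <= s ^+ 4 / 4 by rewrite divr_ge0 // exprn_even_ge0.
  by have := ler_wpM2l s0 h2; rewrite /kap; lra.
pose p := E h x; pose p1 := E (b \o h) x; pose p2 := E (b \o b \o h) x.
have bbh : BH (b \o h) by exact: BH_comp.
have bbbh : BH (b \o b \o h) by exact: BH_comp.
have Ewh s : E (w s \o h) x = p + (z s *: p1 + z2 s *: p2).
  have -> : w s \o h = h + (z s *: (b \o h) + z2 s *: (b \o b \o h)) by [].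
  by rewrite cexpD ?cexpD ?cexpZ //; do ?[apply: BH_D | apply: BH_Z].
(* Im g is a polynomial in s whose constant and linear coefficients are the two quantities to
   identify; a bound of order s^2 makes both vanish. *)
pose g s := hdot (E (w s \o h) x) (w s x).
pose K := (C ^+ 2 * (1 + kap) + kap) * hn x ^+ 2 / 2.
have K0 : 0 <= K.
  by rewrite divr_ge0 // mulr_ge0 ?(ltW X0) // addr_ge0 // mulr_ge0 ?sqr_ge0 // addr_ge0.
have gle s : 0 < s -> s <= 1 -> `|Im (g s)| <= K * s ^+ 2.
  move=> s0 s1; set W := hn (w s x) ^+ 2.
  have s40 : 0 <= s ^+ 4 by rewrite exprn_ge0 ?ltW.
  have s41 : s ^+ 4 <= 1 by apply: exprn_ile1 => //; exact: ltW.
  have XW : hn x ^+ 2 <= W by rewrite /W wn lerDl mulr_ge0 ?divr_ge0 ?sqr_ge0.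
  (* Since w lies in N, E (w (h + i k)) = E (w h) + i k w, and pairing with w x adds k W to Im g.
     The norm of w (h + i k) squared is at most (1 + kap s^4)(C^2 + k^2) = D2. In the resulting
     inequality the k^2 terms cancel up to kap s^4 k^2, because |x|^2 <= W. *)
  have main k : 2 * Im (g s) * k <=
      (C ^+ 2 * (1 + kap) + kap * s ^+ 4 * k ^+ 2) * hn x ^+ 2.
    pose T := h + ('i * k%:C) *: (id : H -> H).
    have bT : BH T by apply/BH_D/BH_Z/BH_id.
    have TE u : T u = h u + ('i * k%:C) *: u by [].
    have Tn u : hn (T u) ^+ 2 = hn (h u) ^+ 2 + k ^+ 2 * hn u ^+ 2.
      rewrite TE hnD2 hdotZr hnZ Re_normM Re_normC normCi mul1r exprMn -normrX.
      rewrite (ger0_norm (sqr_ge0 k)) !(conjM, conj_real, conjCi) !ReImE.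
      by rewrite (selfadjoint_Im u ah); ring.
    have CT u : hn (T u) ^+ 2 <= (C ^+ 2 + k ^+ 2) * hn u ^+ 2.
      rewrite Tn mulrDl lerD2r -exprMn ler_pXn2r // nnegrE ?hn_ge0 //.
      by rewrite mulr_ge0 ?hn_ge0.
    pose D2 := (1 + kap * s ^+ 4) * (C ^+ 2 + k ^+ 2).
    have D20 : 0 <= D2.
      by rewrite mulr_ge0 // addr_ge0 ?sqr_ge0 // mulr_ge0.
    have kp : 0 <= 1 + kap * s ^+ 4 by rewrite addr_ge0 // mulr_ge0.
    have wT : op_bound (Num.sqrt D2) (w s \o T).
      move=> u; rewrite -(@ler_pXn2r _ 2%N) // ?nnegrE ?hn_ge0 ?mulr_ge0 ?sqrtr_ge0 ?hn_ge0 //.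
      rewrite exprMn sqr_sqrtr //; apply: le_trans (wle _ _) _.
      by rewrite /D2 -(mulrA (1 + kap * s ^+ 4)); apply: ler_wpM2l => //; exact: CT.
    have bwT : BH (w s \o T) by apply/BH_comp/bT/NBH.
    have EwT : E (w s \o T) x = E (w s \o h) x + ('i * k%:C) *: w s x.
      have -> : w s \o T = (w s \o h) + ('i * k%:C) *: w s.
        rewrite /T compDr; last exact/NBH.
        by rewrite compZr //; exact/NBH.
      rewrite cexpD ?cexpZ ?(E_fix (Nw s)) //; first exact/NBH.
        by apply/BH_comp/bh/NBH.
      exact/BH_Z/NBH.
    have wx : hn (E (w s \o T) x) <= Num.sqrt D2 * hn x.
      exact: (E_contr (sqrtr_ge0 _) bwT wT).
    have ie : Im (hdot (E (w s \o T) x) (w s x)) = Im (g s) + k * W.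
      by rewrite EwT hdotDl hdotZl hdotxx !ReImE -/W -/(g s); ring.
    have : (Im (g s) + k * W) ^+ 2 <= D2 * hn x ^+ 2 * W.
      rewrite -ie -[leLHS]real_normK ?num_real //.
      rewrite -(sqr_sqrtr D20) -!exprMn ler_pXn2r // ?nnegrE ?mulr_ge0 ?sqrtr_ge0 ?hn_ge0 //.
      apply: le_trans (abs_Im_le _) _; apply: le_trans (cauchy_schwarz _ _) _.
      by rewrite ler_wpM2r ?hn_ge0.
    have W0 : 0 < W by apply: lt_le_trans XW.
    rewrite -mulrA => hsq.
    have h1 : W * (2 * Im (g s) * k + k ^+ 2 * W) <= W * (D2 * hn x ^+ 2).
      by have := sqr_ge0 (Im (g s)); nra.
    rewrite ler_pM2l // in h1.
    have h2 : k ^+ 2 * hn x ^+ 2 <= k ^+ 2 * W by rewrite ler_wpM2l ?sqr_ge0.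
    have h3 : (C ^+ 2 * hn x ^+ 2) * (kap * s ^+ 4) <= (C ^+ 2 * hn x ^+ 2) * kap.
      apply: ler_wpM2l; first exact/mulr_ge0/sqr_ge0/sqr_ge0.
      exact: ler_piMr.
    by move: h1 h2 h3; rewrite /D2; lra.
  have sn : s != 0 by rewrite gt_eqF.
  have e1 : kap * s ^+ 4 * (s ^- 2) ^+ 2 = kap by field.
  have e2 : kap * s ^+ 4 * (- s ^- 2) ^+ 2 = kap by field.
  (* This size of k keeps kap s^4 k^2 constant, and dividing by k gains the factor s^2; the two
     signs bound |Im g|. *)
  have m1 := main (s ^- 2); have m2 := main (- s ^- 2); rewrite e1 in m1; rewrite e2 in m2.
  rewrite ler_norml; have s20 : 0 < s ^- 2 by rewrite invr_gt0 exprn_gt0.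
  have KE : K * s ^+ 2 = (C ^+ 2 * (1 + kap) + kap) * hn x ^+ 2 / (2 * s ^- 2).
    by rewrite /K; field.
  rewrite KE; apply/andP; split; last by rewrite ler_pdivlMr ?mulr_gt0 //; lra.
  by rewrite lerNl ler_pdivlMr ?mulr_gt0 //; lra.
pose c1 := Re (hdot p1 x) - Re (hdot p (b x)).
pose c2 := Im (hdot p1 (b x)) - Im (hdot p2 x) / 2 - Im (hdot p (b (b x))) / 2.
pose c3 := - Re (hdot p1 (b (b x))) / 2 + Re (hdot p2 (b x)) / 2.
pose c4 := Im (hdot p2 (b (b x))) / 4.
have [|cc0 cc1] := @quadratic_small _ (Im (hdot p x)) c1 c2 c3 c4 K.
  move=> s s0 s1; rewrite (_ : _ + _ = Im (g s)); first exact: gle.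
  rewrite /g Ewh wE /z /z2; set c := - (s ^+ 2) / 2.
  have cE : c = - (s ^+ 2) / 2 by [].
  move: c cE => c cE; rewrite !(hdotDl, hdotDr) !(hdotZl, hdotZr).
  rewrite !(conjM, conj_real, conjCi) !ReImE.
  by rewrite cE /c1 /c2 /c3 /c4; field.
by split; [exact: cc0|]; move/eqP: cc1; rewrite subr_eq0 => /eqP.
Qed.

(** By the first half of [cexp_selfadjoint], with b the identity, E preserves self-adjointness;
    Cartesian parts carry this to all T. *)
Lemma cexp_adjoint T S : BH T -> adjoint_pair T S -> adjoint_pair (E T) (E S).
Proof.
move=> bT aTS; have bS := adjoint_BH bT aTS.
have sa h : BH h -> adjoint_pair h h -> adjoint_pair (E h) (E h).
  move=> bh ah; apply: selfadjoint_of_Im; first exact: E_BH.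
  move=> x; have a0 : adjoint_pair (id : H -> H) id by [].
  by case: (cexp_selfadjoint x bh ah (commutant_id Y) a0).
have bh : BH (re_part S T) by apply/BH_Z/BH_D.
have bk : BH (im_part S T) by apply/BH_Z/BH_B.
have bik : BH ('i *: im_part S T) by exact: BH_Z.
have -> : E T = E (re_part S T) + 'i *: E (im_part S T).
  by rewrite -cexpZ // -cexpD // -re_im_part.
have -> : E S = E (re_part S T) - 'i *: E (im_part S T).
  by rewrite -cexpZ // -cexpB // -re_im_part_adj.
have a1 := sa _ bh (re_part_adj aTS).
have a2 := adjointZ 'i (sa _ bk (im_part_adj aTS)).
by have := adjointD a1 a2; rewrite conjCi scaleNr.
Qed.

(* The symmetrized form of Tomiyama's bimodule property. *)
Lemma cexp_jordan u v T : N u -> N v -> adjoint_pair u v -> BH T ->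
  E ((u \o T) + (T \o u)) = (u \o E T) + (E T \o u).
Proof.
move=> Nu Nv auv bT.
(* For self-adjoint b and h, h b is the adjoint of b h. Both sides thus have quadratic forms that
   are twice a real part, and these agree by [cexp_selfadjoint]. Linearity in T and then in u gives
   the general case. *)
have jsa b h : N b -> adjoint_pair b b -> BH h -> adjoint_pair h h ->
    E ((b \o h) + (h \o b)) = (b \o E h) + (E h \o b).
  move=> Nb ab bh ah; have bb := NBH Nb; have bEh := E_BH bh.
  have c1 : BH (b \o h) by exact: BH_comp.
  have c2 : BH (h \o b) by exact: BH_comp.
  have c3 : BH (b \o E h) by exact: BH_comp.
  have c4 : BH (E h \o b) by exact: BH_comp.
  apply/eqP; rewrite -subr_eq0; apply/eqP/quadratic_eq0.
    by apply: BH_B; [apply/E_BH/BH_D | exact: BH_D].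
  move=> x; rewrite cexpD //.
  rewrite -[(_ - _) x]/(E (b \o h) x + E (h \o b) x - (b (E h x) + E h (b x))).
  have aE := cexp_adjoint bh ah.
  have aE2 := cexp_adjoint c1 (adjoint_comp ab ah).
  have [_ e] := cexp_selfadjoint x bh ah Nb ab.
  rewrite hdotBl !hdotDl (adjoint_sym aE2) ab (aE (b x)) (hdotC (E (b \o h) x)).
  rewrite (hdotC (E h x) (b x)); apply: complex_ext; rewrite !ReImE ?e; ring.
have jh b : N b -> adjoint_pair b b -> E ((b \o T) + (T \o b)) = (b \o E T) + (E T \o b).
  move=> Nb ab; have bb := NBH Nb; have [S bS aTS] := adjoint_exists bT.
  have bh : BH (re_part S T) by apply/BH_Z/BH_D.
  have bk : BH (im_part S T) by apply/BH_Z/BH_B.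
  have := jsa b _ Nb ab bh (re_part_adj aTS); have := jsa b _ Nb ab bk (im_part_adj aTS).
  rewrite [in X in _ -> _ -> X](re_im_part S T).
  move: (re_part S T) (im_part S T) bh bk => h k bh bk jk jhh.
  have bZ : BH ('i *: k) by exact: BH_Z.
  have -> : (b \o (h + 'i *: k)) + ((h + 'i *: k) \o b) =
      ((b \o h) + (h \o b)) + 'i *: ((b \o k) + (k \o b)).
    by rewrite compDr // compZr // scalerDr compDl addrACA.
  have d1 : BH ((b \o h) + (h \o b)) by apply: BH_D; exact: BH_comp.
  have d2 : BH ((b \o k) + (k \o b)) by apply: BH_D; exact: BH_comp.
  rewrite (cexpD bh bZ) (cexpZ _ bk) (cexpD d1 (BH_Z _ d2)) (cexpZ _ d2).
  rewrite jk jhh compDr // compZr // scalerDr compDl addrACA.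
  by [].
have bu := NBH Nu; have bv := NBH Nv.
have Nr : N (re_part v u) by apply: commutantZ => //; exact: commutantD.
have Ni : N (im_part v u) by apply: commutantZ => //; exact: commutantB.
have := jh _ Nr (re_part_adj auv); have := jh _ Ni (im_part_adj auv).
rewrite [in X in _ -> _ -> X](re_im_part v u).
move: (re_part v u) (im_part v u) Nr Ni => c d Nc Nd jd jc.
have [bc bd] := (NBH Nc, NBH Nd); have bET := E_BH bT.
have -> : ((c + 'i *: d) \o T) + (T \o (c + 'i *: d)) =
    ((c \o T) + (T \o c)) + 'i *: ((d \o T) + (T \o d)).
  by rewrite (compDr _ _ bT) (compZr _ _ bT) scalerDr compDl addrACA.
have d1 : BH ((c \o T) + (T \o c)) by apply: BH_D; exact: BH_comp.
have d2 : BH ((d \o T) + (T \o d)) by apply: BH_D; exact: BH_comp.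
rewrite (cexpD d1 (BH_Z _ d2)) (cexpZ _ d2).
by rewrite jd jc (compDr _ _ bET) (compZr _ _ bET) scalerDr compDl addrACA.
Qed.

End ContractiveProjection.

(** * Hypertraces *)

Section Hypertrace.
Variables (R : realType) (H : hilbertType R) (Y : set (H -> H)).
Variable E : (H -> H) -> (H -> H).
Hypothesis bY : Y `<=` @BH R H.
Let N := commutant Y.
Hypothesis E_lin : forall (k : R[i]) S T, BH S -> BH T -> E (k *: S + T) = k *: E S + E T.
Hypothesis E_in : forall T, BH T -> N (E T).
Hypothesis E_fix : forall T, N T -> E T = T.
Hypothesis E_contr : forall T C, 0 <= C -> BH T -> op_bound C T -> op_bound C (E T).
Variable Om : H.
Hypothesis Om1 : hn Om = 1.
Implicit Types (x y : H) (S T X b : H -> H).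

Definition vstate T : R[i] := hdot (T Om) Om.

Lemma vstateD S T : vstate (S + T) = vstate S + vstate T.
Proof. exact: hdotDl. Qed.

Lemma vstateZ k T : vstate (k *: T) = k * vstate T.
Proof. exact: hdotZl. Qed.

Lemma vstateN T : vstate (- T) = - vstate T.
Proof. exact: hdotNl. Qed.

Let m T := vstate (E T).

Let mD S T : BH S -> BH T -> m (S + T) = m S + m T.
Proof. by move=> bS bT; rewrite /m (cexpD E_lin) // vstateD. Qed.

Let mZ k T : BH T -> m (k *: T) = k * m T.
Proof. by move=> bT; rewrite /m (cexpZ bY E_lin E_fix) // vstateZ. Qed.

Let mB S T : BH S -> BH T -> m (S - T) = m S - m T.
Proof.
by move=> bS bT; rewrite /m (cexpB bY E_lin E_fix) // /vstate -hdotBl.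
Qed.

Lemma vstate_cexp_bound T C : 0 <= C -> BH T -> op_bound C T -> Re `|vstate (E T)| <= C.
Proof.
move=> C0 bT hT; apply: le_trans (cauchy_schwarz _ _) _; rewrite Om1 mulr1.
by have := E_contr C0 bT hT Om; rewrite Om1 mulr1.
Qed.

(* The second difference of n |-> m (u^n T v^n) vanishes, and that sequence is
   bounded. *)
Lemma hypertrace_unitary u v T : N u -> N v -> adjoint_pair u v ->
  u \o v = id -> v \o u = id ->
  (forall X, N X -> vstate (u \o X) = vstate (X \o u)) ->
  BH T -> vstate (E (u \o T \o v)) = vstate (E T).
Proof.
move=> Nu Nv auv uv vu tr bT.
have bu := commutant_BH Nu; have bv := commutant_BH Nv.
have isou x : hn (u x) = hn x.
  apply/eqP; rewrite -(@eqrXn2 _ 2%N) ?hn_ge0 //; apply/eqP.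
  have := hdotxx (u x); rewrite auv -[v (u x)]/((v \o u) x) vu hdotxx.
  by move=> /(congr1 (@Re R)); rewrite !ReC => ->.
have isov x : hn (v x) = hn x by rewrite -[in LHS](isou (v x)) -[u (v x)]/((u \o v) x) uv.
have trv X : N X -> vstate (u \o X \o v) = vstate X.
  move=> NX; rewrite (tr (X \o v)); last exact: commutant_comp.
  by rewrite -compA vu.
have trv' X : N X -> vstate (v \o X \o u) = vstate X.
  move=> NX; rewrite -(tr (v \o X)); last exact: commutant_comp.
  by rewrite compA uv.
(* The Jordan identity is used for v on S and then for u on S1. Since u S1 + S1 u = 2 S + u S v + v
   S u, and likewise for E S, the trace property on N evaluates the right side to 4 m(S). *)
have two S : BH S -> m (u \o S \o v) + m (v \o S \o u) = 2 * m S.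
  move=> bS; pose S1 := (v \o S) + (S \o v).
  have bS1 : BH S1 by apply: BH_D; exact: BH_comp.
  have bA : BH (u \o S \o v) by apply/BH_comp/bv/BH_comp.
  have bB : BH (v \o S \o u) by apply/BH_comp/bu/BH_comp.
  have NE := E_in bS; have bE := commutant_BH NE.
  have e1 : (u \o S1) + (S1 \o u) = 2 *: S + ((u \o S \o v) + (v \o S \o u)).
    rewrite /S1 (compDr _ _ bu) compDl compA uv -[S \o v \o u]compA vu.
    rewrite -[id \o S]/S -[S \o id]/S addrACA (addrC (u \o _)) addrCA !addrA.
    by rewrite (_ : 2 *: S = S + S) ?scaler_nat // addrAC.
  have := cexp_jordan bY E_lin E_in E_fix E_contr Nu Nv auv bS1.
  rewrite e1 (cexp_jordan bY E_lin E_in E_fix E_contr Nv Nu (adjoint_sym auv) bS).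
  move=> /(congr1 vstate).
  rewrite (cexpD E_lin (BH_Z _ bS) (BH_D bA bB)) (cexpZ bY E_lin E_fix _ bS).
  rewrite (cexpD E_lin bA bB) (compDr _ _ bu) compDl !vstateD vstateZ.
  have q1 : u \o (v \o E S) = E S by rewrite compA uv.
  have q2 : E S \o v \o u = E S by rewrite -compA vu.
  rewrite q1 q2 compA trv // trv' // -/(m S) -/(m (u \o S \o v)) -/(m (v \o S \o u)) => h.
  by apply: (addrI (2 * m S)); rewrite h; ring.
pose Ad S := u \o S \o v.
have bAd S : BH S -> BH (Ad S) by move=> bS; apply/BH_comp/bv/BH_comp.
pose Tn n := iter n Ad T.
have bTn n : BH (Tn n) by elim: n => //= n IH; exact: bAd.
have [C C0 hC] := BH_bound bT.
have hTn n : op_bound C (Tn n).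
  by elim: n => //= n IH x; rewrite /Ad /= isou; apply: le_trans (IH _) _; rewrite isov.
have step n : m (Tn n.+2) + m (Tn n) = 2 * m (Tn n.+1).
  rewrite -two //; congr (_ + m _); apply/funext => x.
  have vuE z : v (u z) = z by exact: (congr1 (fun f => f z) vu).
  by rewrite /Tn /= /Ad /= !vuE.
pose d := m (Ad T) - m T.
have arith n : m (Tn n) = m T + n%:R * d /\ m (Tn n.+1) = m T + n.+1%:R * d.
  elim: n => [|n [IH1 IH2]]; first by split; rewrite ?mul0r ?addr0 // mul1r addrC subrK.
  split=> //; have := step n; rewrite IH1 IH2 => h.
  apply: (addIr (m T + n%:R * d)); rewrite h -addn2 -addn1 !natrD; ring.
suff : d = 0 by move/eqP; rewrite subr_eq0 => /eqP.
apply: Re_norm_le0; rewrite leNgt; apply/negP => d0.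
(* The conjugates of T by unitaries keep the bound C, so n |d| <= 2 C for every n; this n violates
   it. *)
pose n := (Num.trunc (2 * C / Re `|d|)).+1.
have hn1 : 2 * C < n%:R * Re `|d| by rewrite -ltr_pdivrMr //; exact: truncnS_gt.
have e : n%:R * d = m (Tn n) - m T by rewrite (arith n).1 addrAC subrr add0r.
have : Re `|n%:R * d| <= C + C.
  rewrite e; apply: le_trans (Re_normD _ _) _; rewrite normrN.
  by apply: lerD; apply: vstate_cexp_bound.
have nC : n%:R = (n%:R : R)%:C by rewrite rmorph_nat.
by rewrite Re_normM nC Re_normC ger0_norm ?ler0n //; lra.
Qed.

(** With s the inverse of 1 + b^2 and d = b s, the Cayley transforms of b are combinations of s, d
    and 1, and conversely. Invariance under these unitaries thus lets s and d pass across T inside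
    m, and b is recovered from b = d (1 + b^2). *)
Lemma hypertrace_selfadjoint b T : N b -> adjoint_pair b b ->
  (forall X, N X -> vstate (b \o X) = vstate (X \o b)) ->
  BH T -> vstate (E (b \o T)) = vstate (E (T \o b)).
Proof.
move=> Nb ab trb; have bb := commutant_BH Nb.
have [s [bs as_ hs sh]] := inverse_one_plus_sqr bb ab.
(* s commutes with every bounded operator commuting with b; this places s in N. *)
have scomm S : BH S -> (forall x, S (b x) = b (S x)) -> forall x, s (S x) = S (s x).
  move=> bS h x; rewrite -{1}(hs x) (BHD _ _ bS) h h; exact: sh.
have sb x : s (b x) = b (s x) by apply: scomm.
have Ns : N s.
  split=> // S YS; apply/funext => x /=; apply: scomm; first exact: bY.
  by move=> z; have := Nb.2 S YS => /(congr1 (fun f => f z)).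
pose d := b \o s.
have Nd : N d by exact: commutant_comp.
have ad : adjoint_pair d d by move=> x y; rewrite /d /= ab as_ sb.
have idN : N id := commutant_id Y.
(* For j^2 = -1 this is (1 + j b)(1 - j b)^-1, with the denominator cleared by 1 + b^2 = (1 + j b)(1
   - j b). *)
pose cay (j : R[i]) : H -> H := (2 *: s - id) + (2 * j) *: d.
have cayN j : N (cay j).
  by apply: commutantD => //; [apply: commutantB => //|]; apply: commutantZ.
have cayE j x : cay j x = 2 *: s x - x + (2 * j) *: b (s x) by [].
have cay_adj (j : R[i]) : j^* = - j -> adjoint_pair (cay j) (cay (- j)).
  move=> cj; apply: adjointD.
    apply: adjointD; first by have := adjointZ 2 as_; rewrite rmorph_nat.
    by have := adjointZ (-1) (fun x y : H => erefl (hdot x y)); rewrite rmorphN1 !scaleN1r.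
  by have := adjointZ (2 * j) ad; rewrite rmorphM /= rmorph_nat cj.
have cayK (j : R[i]) : j * j = -1 -> cay j \o cay (- j) = id.
  move=> jj; apply/funext => x /=; pose e := s (s x).
  have hsx : s x = e + b (b e) by rewrite /e hs.
  have hx : x = e + b (b e) + (b (b e) + b (b (b (b e)))).
    by rewrite -[LHS]hs hsx !(BHD _ _ bb).
  have c1 : cay (- j) x = e - b (b (b (b e))) + (2 * - j) *: (b e + b (b (b e))).
    rewrite cayE hsx {1}hx (BHD _ _ bb); apply: hdot_ext => z.
    by rewrite !hdotE; ring.
  have c2 : s (cay (- j) x) = e - b (b e) + (2 * - j) *: b e.
    rewrite -[RHS]sh c1; congr (s _).
    rewrite !(BHD _ _ bb, BHN _ bb, BHZ _ _ bb).
    by apply: hdot_ext => z; rewrite !hdotE; ring.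
  rewrite cayE c2 c1 [RHS]hx !(BHD _ _ bb, BHN _ bb, BHZ _ _ bb).
  by apply: hdot_ext => z; rewrite !hdotE; ring: jj.
(* With Z = s X s one has X s = (1 + b^2) Z and s X = Z (1 + b^2), so the trace property of b, used
   twice, gives that of s. *)
have trs X : N X -> vstate (s \o X) = vstate (X \o s).
  move=> NX; pose Z := s \o X \o s.
  have NZ : N Z by do 2 apply: commutant_comp => //.
  have bX := commutant_BH NX.
  have -> : X \o s = Z + (b \o (b \o Z)) by apply/funext => x; rewrite -[LHS]hs.
  have -> : s \o X = Z + (Z \o b \o b).
    apply/funext => x /=; rewrite -[RHS]/(Z x + Z (b (b x))) /Z /=.
    by rewrite -(BHD _ _ bs) -(BHD _ _ bX) -(BHD _ _ bs) sh.
  rewrite !vstateD trb; last exact: commutant_comp.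
  by rewrite -trb //; exact: commutant_comp.
have trd X : N X -> vstate (d \o X) = vstate (X \o d).
  move=> NX; rewrite /d -compA trb; last exact: commutant_comp.
  rewrite -compA trs; last exact: commutant_comp.
  by rewrite -compA; congr (vstate (X \o _)); apply/funext => x /=; rewrite sb.
have trcay j X : N X -> vstate (cay j \o X) = vstate (X \o cay j).
  move=> NX; have bX := commutant_BH NX.
  rewrite /cay !(compDr _ _ bX) !compDl !vstateD !(compZr _ _ bX) !compZl !vstateZ.
  by rewrite trs // trd // (compNr _ bX).
have ii : ('i * 'i = -1 :> R[i]) by rewrite -expr2 sqrCi.
have nii : ((- 'i) * (- 'i) = -1 :> R[i]) by rewrite mulrNN.
pose u := cay 'i; pose v := cay (- 'i).
have auv : adjoint_pair u v by apply: cay_adj; rewrite conjCi.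
have uv : u \o v = id by exact: cayK.
have vu : v \o u = id by have := cayK _ nii; rewrite opprK.
have bu : BH u := commutant_BH (cayN 'i).
have bv : BH v := commutant_BH (cayN (- 'i)).
have key S : BH S -> m (u \o S \o v) = m S.
  by exact: (hypertrace_unitary (cayN 'i) (cayN (- 'i)) auv uv vu (trcay 'i)).
have uvE x : u (v x) = x by exact: (congr1 (fun f => f x) uv).
have mu S : BH S -> m (u \o S) = m (S \o u).
  move=> bS; rewrite -(key _ (BH_comp bS bu)); congr m.
  by apply/funext => x; rewrite -[RHS]/(u (S (u (v x)))) uvE.
have mv S : BH S -> m (v \o S) = m (S \o v).
  move=> bS; rewrite -(key _ (BH_comp bv bS)); congr m.
  by apply/funext => x; rewrite -[LHS]/(u (v (S (v x)))) uvE.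
(* By the definition of [cay], u + v = 4 s - 2 and u - v = 4 i d. *)
have sE : s = 4^-1 *: (u + v) + 2^-1 *: id.
  apply/funext => x; apply: hdot_ext => z.
  rewrite -[X in _ = hdot X _]/(4^-1 *: (cay 'i x + cay (- 'i) x) + 2^-1 *: x) !cayE !hdotE.
  by field.
have dE : d = (- 'i / 4) *: (u - v).
  apply/funext => x; apply: hdot_ext => z.
  rewrite -[X in _ = hdot X _]/((- 'i / 4) *: (cay 'i x - cay (- 'i) x)) !cayE !hdotE.
  transitivity (- ('i * 'i) * hdot (b (s x)) z); first by rewrite ii opprK mul1r.
  by field.
clearbody u v.
have ms S : BH S -> m (s \o S) = m (S \o s).
  move=> bS; rewrite sE (compDr _ _ bS) !(compZr _ _ bS) (compDr _ _ bS) compDl !compZl compDl.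
  have b1 : BH (u \o S) by exact: BH_comp.
  have b2 : BH (v \o S) by exact: BH_comp.
  have b3 : BH (S \o u) by exact: BH_comp.
  have b4 : BH (S \o v) by exact: BH_comp.
  rewrite (mD (BH_Z _ (BH_D b1 b2)) (BH_Z _ bS)) (mD (BH_Z _ (BH_D b3 b4)) (BH_Z _ bS)).
  by rewrite (mZ _ (BH_D b1 b2)) (mZ _ (BH_D b3 b4)) (mD b1 b2) (mD b3 b4) mu // mv.
have md S : BH S -> m (d \o S) = m (S \o d).
  move=> bS; rewrite dE (compZr _ _ bS) (compDr _ _ bS) (compNr _ bS) compZl compDl compNl.
  have b1 : BH (u \o S) by exact: BH_comp.
  have b2 : BH (v \o S) by exact: BH_comp.
  have b3 : BH (S \o u) by exact: BH_comp.
  have b4 : BH (S \o v) by exact: BH_comp.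
  by rewrite (mZ _ (BH_B b1 b2)) (mZ _ (BH_B b3 b4)) (mB b1 b2) (mB b3 b4) mu // mv.
(* With W = (1 + b^2) T the chain is m(b T) = m(d W) = m(W d) = m(W b s) = m(s W b) = m(T b). *)
move=> bT; pose W := T + (b \o (b \o T)).
have bW : BH W by apply: BH_D => //; do 2 apply: BH_comp => //.
have -> : b \o T = d \o W by apply/funext => x; rewrite /d /W /= sh.
rewrite -/(m _) md // -/(m _).
have -> : W \o d = (W \o b) \o s.
  by apply/funext => x /=; rewrite /d.
rewrite -ms; last exact: BH_comp.
by congr m; apply/funext => x /=; exact: sh.
Qed.

(** Both sides are linear in u, so the Cartesian parts suffice; the trace property is asked of u and
    of its adjoint so that both parts inherit it. *)
Lemma hypertrace u v T : N u -> N v -> adjoint_pair u v ->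
  (forall X, N X -> vstate (u \o X) = vstate (X \o u)) ->
  (forall X, N X -> vstate (v \o X) = vstate (X \o v)) ->
  BH T -> vstate (E (u \o T)) = vstate (E (T \o u)).
Proof.
move=> Nu Nv auv tru trv bT; have [bu bv] := (commutant_BH Nu, commutant_BH Nv).
have Nr : N (re_part v u) by apply: commutantZ => //; exact: commutantD.
have Ni : N (im_part v u) by apply: commutantZ => //; exact: commutantB.
have trr X : N X -> vstate (re_part v u \o X) = vstate (X \o re_part v u).
  move=> NX; have bX := commutant_BH NX; rewrite /re_part (compZr _ _ bX) (compDr _ _ bX).
  by rewrite compZl compDl !vstateZ !vstateD tru // trv.
have tri X : N X -> vstate (im_part v u \o X) = vstate (X \o im_part v u).
  move=> NX; have bX := commutant_BH NX; rewrite /im_part (compZr _ _ bX) (compDr _ _ bX).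
  by rewrite (compNr _ bX) compZl compDl compNl !(vstateZ, vstateD, vstateN) tru // trv.
have hr := hypertrace_selfadjoint Nr (re_part_adj auv) trr bT.
have hi := hypertrace_selfadjoint Ni (im_part_adj auv) tri bT.
rewrite (re_im_part v u); move: (re_part v u) (im_part v u) Nr Ni hr hi => c d.
move=> /commutant_BH bc /commutant_BH bd hr hi.
have c1 : BH (c \o T) by exact: BH_comp.
have c2 : BH (d \o T) by exact: BH_comp.
have c3 : BH (T \o c) by exact: BH_comp.
have c4 : BH (T \o d) by exact: BH_comp.
rewrite compDl compZl (compDr _ _ bT) (compZr _ _ bT) -/(m _) -/(m ((T \o c) + _)).
rewrite (mD c1 (BH_Z _ c2)) (mD c3 (BH_Z _ c4)) (mZ _ c2) (mZ _ c4).
by rewrite /m hr hi.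
Qed.

End Hypertrace.

(** * Coproducts with values in A ⊗ A *)

Local Open Scope qgroup_scope.

Section CompactCoproduct.
Variables (R : realType) (A : starAlgType R).
Variable Delta : A -> tensor A A -> tensor A A.
Variable e : A.
Hypothesis hopf : multiplier_hopf Delta.
Hypothesis unit_e : is_unit e.
Implicit Types (a b c d : A) (x y : tensor A A).

Lemma unit_star : e^⋆ = e.
Proof. by have [h _] := unit_e e^⋆; rewrite -[RHS]astarK -h astarM astarK h. Qed.

Lemma amul0r (B : starAlgType R) (a : B) : a ∙ 0 = 0.
Proof. by apply: (addrI (a ∙ 0)); rewrite -amulDr !addr0. Qed.

Lemma amul0l (B : starAlgType R) (a : B) : 0 ∙ a = 0.
Proof. by apply: (addrI (0 ∙ a)); rewrite -amulDl !addr0. Qed.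

Lemma tensM a b c d : (a ⊗ b) ∙ (c ⊗ d) = (a ∙ c) ⊗ (b ∙ d).
Proof. exact: tmul_tens. Qed.

Lemma tensor_unit x : (e ⊗ e) ∙ x = x /\ x ∙ (e ⊗ e) = x.
Proof.
elim/tensor_ind: x => [|a b x [IH1 IH2]]; first by rewrite amul0r amul0l.
rewrite amulDr amulDl IH1 IH2 !tensM.
by have [-> ->] := unit_e a; have [-> ->] := unit_e b.
Qed.

Lemma tmap_amul_id a x : tmap (amul a) id x = (a ⊗ e) ∙ x.
Proof.
have bal : balanced (fun c d => (a ∙ c) ⊗ (id d : A)).
  by apply: balanced_tmap => //; exact: amul_linear.
elim/tensor_ind: x => [|c d x IH]; first by rewrite amul0r /tmap tlift0.
rewrite /tmap tliftD // tlift_tens // -/(tmap _ _ _) IH amulDr tensM.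
by have [-> _] := unit_e d.
Qed.

(** With a unit e, multipliers of the tensor square are left multiplications. The image of a ⊗ e
    under the bijection of the Hopf axioms is the tensor implementing [Delta a]. *)
Lemma compact_coproduct : exists D : A -> tensor A A,
  [/\ forall a b, is_Delta_l Delta a b (D a ∙ (b ⊗ e)),
      forall a b, D (a ∙ b) = D a ∙ D b
    & forall a, D a^⋆ = (D a)^⋆].
Proof.
case: hopf => _ [[_ _ DM DS] _] _ [T [_ hT]] _; pose D a := T (a ⊗ e).
have DE a : amul (D a) = Delta a.
  rewrite /D (hT a e); apply/funext => x /=; rewrite tmap_amul_id.
  by have [-> _] := tensor_unit x.
exists D; split=> [a b|a b|a].
- by apply/funext => x /=; rewrite -amulA tmap_amul_id -DE.
- have [_ h] := tensor_unit (D (a ∙ b)); rewrite -h DE DM /= -!DE.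
  by have [_ ->] := tensor_unit (D b).
(* The adjoint relation between [Delta a] and [Delta] of the star of a is read off at the unit
   tensor. *)
- have := DS a (e ⊗ e) (e ⊗ e); rewrite -!DE.
  have [_ ->] := tensor_unit (D a); have [_ ->] := tensor_unit (D a^⋆).
  have [_ ->] := tensor_unit (D a)^⋆ => ->.
  have -> : (e ⊗ e)^⋆ = e ⊗ e by rewrite [LHS]tstar_tens unit_star.
  by have [-> _] := tensor_unit (D a^⋆).
Qed.

Lemma tlift_sum (V : zmodType) (f : A -> A -> V) I (s : seq I) (F : I -> tensor A A) :
  balanced f -> tlift f (\sum_(i <- s) F i) = \sum_(i <- s) tlift f (F i).
Proof.
move=> bf; elim: s => [|i s IH]; first by rewrite !big_nil tlift0.
by rewrite !big_cons tliftD // IH.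
Qed.

Lemma amul_suml (B : starAlgType R) I (s : seq I) (F : I -> B) (b : B) :
  (\sum_(i <- s) F i) ∙ b = \sum_(i <- s) F i ∙ b.
Proof.
elim: s => [|i s IH]; first by rewrite !big_nil amul0l.
by rewrite !big_cons amulDl IH.
Qed.

Lemma amul_sumr (B : starAlgType R) I (s : seq I) (F : I -> B) (b : B) :
  b ∙ (\sum_(i <- s) F i) = \sum_(i <- s) b ∙ F i.
Proof.
elim: s => [|i s IH]; first by rewrite !big_nil amul0r.
by rewrite !big_cons amulDr IH.
Qed.

Lemma astar_sum (B : starAlgType R) I (s : seq I) (F : I -> B) :
  (\sum_(i <- s) F i)^⋆ = \sum_(i <- s) (F i)^⋆.
Proof.
have s0 : (0 : B)^⋆ = 0 by apply: (addrI (0 : B)^⋆); rewrite -astarD !addr0.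
elim: s => [|i s IH]; first by rewrite !big_nil s0.
by rewrite !big_cons astarD IH.
Qed.

(* The left invariance (id ⊗ phi)(Δ(c d^⋆)) = phi(c d^⋆) 1, with phi(c_2 d_2^⋆)
   and phi(c d^⋆) rewritten by traciality. *)
Lemma invariance_sum (phi : {scalar A}) (D : A -> tensor A A) c d :
  left_invariant Delta phi -> tracial phi ->
  (forall a b, is_Delta_l Delta a b (D a ∙ (b ⊗ e))) ->
  (forall a b, D (a ∙ b) = D a ∙ D b) -> (forall a, D a^⋆ = (D a)^⋆) ->
  \sum_(p <- repr (D c)) \sum_(q <- repr (D d))
    phi (q.2^⋆ ∙ p.2) *: (p.1 ∙ q.1^⋆) = phi (d^⋆ ∙ c) *: e.
Proof.
move=> li tr Dl DM DS; pose g (x y : A) := phi y *: x.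
have bg : balanced g.
  split=> [x x' y|x y y'|k x y]; rewrite /g ?scalerDr ?linearD ?scalerDl //=.
  have -> : phi (k *: y) = k * phi y by exact: linearZ.
  by rewrite !scalerA mulrC.
have inv := li (c ∙ d^⋆) e _ (Dl _ _).
move: inv; rewrite (tensor_unit _).2 -/g DM DS tr => <-.
rewrite [in RHS](tensor_sum (D c)) [in RHS](tensor_sum (D d)) astar_sum amul_suml.
rewrite tlift_sum //; apply: eq_bigr => p _.
rewrite amul_sumr tlift_sum //; apply: eq_bigr => q _.
by rewrite [(_ ⊗ _)^⋆]tstar_tens tensM tlift_tens // /g tr.
Qed.

End CompactCoproduct.

(** * Tails of convergent series *)

Section Series.
Variable R : realType.

Lemma series_toP (u : nat -> R[i]) l : series_to u l -> forall d : R, 0 < d ->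
  exists M, forall n, (M <= n)%N -> Re `|l - \sum_(0 <= k < n) u k| <= d.
Proof.
move=> /cvgrPdist_lt hu d d0; have [|M _ hM] := hu d%:C; first by rewrite ltcR.
exists M => n Mn; have := ltW (hM n Mn).
by rewrite lecE ReC => /andP[_].
Qed.

(** Once a partial sum is within d of the supremum, every later block of nonnegative terms sums to
    at most d. *)
Lemma bounded_tail (a : nat -> R) r : (forall n, 0 <= a n) ->
  (forall n, \sum_(0 <= k < n) a k <= r) -> forall d, 0 < d ->
  exists M, forall n p, (M <= n)%N -> \sum_(n <= k < p) a k <= d.
Proof.
move=> a0 ar d d0; pose P n := \sum_(0 <= k < n) a k.
have supP : has_sup (range P) by split; [exists (P 0%N), 0%N | exists r => _ [n _ <-]; exact: ar].
have [_ [M _ <-] hM] := sup_adherent d0 supP; exists M => n p Mn.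
have [np|pn] := leqP n p; last by rewrite big_geq ?ltW // ltnW.
have e1 : P p = P M + \sum_(M <= k < n) a k + \sum_(n <= k < p) a k.
  by rewrite /P -!big_cat_nat // (leq_trans Mn).
have h1 : 0 <= \sum_(M <= k < n) a k by apply: sumr_ge0.
have h2 : P p <= sup (range P) by apply: ub_le_sup; [exact: supP.2 | exists p].
lra.
Qed.

End Series.

(** * Slices *)

Section SliceMean.
Variables (R : realType) (H K : hilbertType R) (t : H -> H -> K).
Hypothesis ht : hilbert_tensor t.
Variables (X : K -> K) (CX : R).
Hypotheses (CX0 : 0 <= CX) (bX : BH X) (hX : op_bound CX X).
Variables (m : (H -> H) -> R[i]) (l0 : R[i]).
Hypothesis mD : forall S T, BH S -> BH T -> m (S + T) = m S + m T.
Hypothesis mZ : forall k T, BH T -> m (k *: T) = k * m T.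
Hypothesis m_bound : forall T C, 0 <= C -> BH T -> op_bound C T -> Re `|m T| <= C.
Implicit Types (u v xi eta : H) (S T : H -> H).

Lemma htensDl u u' v : t (u + u') v = t u v + t u' v.
Proof. by case: ht => tl _ _ _; have := tl v 1 u u'; rewrite !scale1r. Qed.

Lemma htensDr u v v' : t u (v + v') = t u v + t u v'.
Proof. by case: ht => _ tr _ _; have := tr u 1 v v'; rewrite !scale1r. Qed.

Lemma htensBr u v v' : t u (v - v') = t u v - t u v'.
Proof. by apply/eqP; rewrite eq_sym subr_eq -htensDr subrK. Qed.

Lemma hn_htens u v : hn (t u v) = hn u * hn v.
Proof.
case: ht => _ _ td _; apply/eqP; rewrite -(@eqrXn2 _ 2%N) ?mulr_ge0 ?hn_ge0 // exprMn.
have := td u v u v; rewrite !hdotxx => /(congr1 (@Re R)).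
by rewrite ReM !ReC !ImC mulr0 subr0 => ->.
Qed.

(** The sesquilinear form of the slice of X by the vector functional T |-> (T xi, eta) in the second
    leg. *)
Definition slice_form xi eta u v : R[i] := hdot (X (t u xi)) (t v eta).

Lemma slice_form_le xi eta u v :
  Re `|slice_form xi eta u v| <= CX * (hn xi * hn eta) * hn u * hn v.
Proof.
apply: le_trans (cauchy_schwarz _ _) _; rewrite (hn_htens v).
have := hX (t u xi); rewrite hn_htens => h.
have p : 0 <= hn v * hn eta by rewrite mulr_ge0 ?hn_ge0.
apply: le_trans (ler_wpM2r p h) _.
by rewrite le_eqVlt; apply/orP; left; apply/eqP; ring.
Qed.

Lemma slice_form_op xi eta : exists T,
  [/\ BH T, op_bound (CX * (hn xi * hn eta)) T
    & forall u v, hdot (T u) v = slice_form xi eta u v].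
Proof.
case: ht => tl _ _ _.
apply: sesquilinear_op => [k u u' v|k u v v'|u v]; last exact: slice_form_le.
  by rewrite /slice_form (tl xi) bX.1 hdotPl.
by rewrite /slice_form (tl eta) hdotDr hdotZr.
Qed.

Lemma op_bound_of_form T C : 0 <= C ->
  (forall u v, Re `|hdot (T u) v| <= C * hn u * hn v) -> op_bound C T.
Proof.
move=> C0 h u; have h1 : hn (T u) ^+ 2 <= C * hn u * hn (T u).
  rewrite -[leLHS]ReC -hdotxx; apply: le_trans (h u (T u)).
  exact: le_trans (ler_norm _) (abs_Re_le _).
have [->|ne] := eqVneq (hn (T u)) 0; first by rewrite mulr_ge0 ?hn_ge0.
by move: h1; rewrite expr2 ler_pM2r // lt_neqAle eq_sym ne hn_ge0.
Qed.

Let mB S T : BH S -> BH T -> m (S - T) = m S - m T.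
Proof.
move=> bS bT; rewrite mD //; last exact: BH_N.
by rewrite -scaleN1r mZ // mulN1r.
Qed.

(** The slice depends continuously in operator norm on xi and eta, and m is norm bounded, so the
    identity passes from V to its closure. Here l0 stands for the value of the mean at the operator
    being sliced. *)
Lemma slice_mean_vectors (V : set H) : dense V ->
  (forall xi eta, V xi -> V eta -> forall T, BH T ->
     (forall u v, hdot (T u) v = slice_form xi eta u v) -> m T = hdot xi eta * l0) ->
  forall xi eta T, BH T ->
    (forall u v, hdot (T u) v = slice_form xi eta u v) -> m T = hdot xi eta * l0.
Proof.
move=> dV hV xi eta T bT hT; apply/eqP; rewrite -subr_eq0; apply/eqP/Re_norm_le0.
pose B := (CX + Re `|l0|) * (hn xi + 1 + hn eta).
apply: (@le0_of_small _ _ B) => d d0 d1.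
have [x Vx xd] := dense_hn xi dV d0; have [y Vy yd] := dense_hn eta dV d0.
have [S [bS _ hS]] := slice_form_op x y.
have ES := hV x y Vx Vy S bS hS.
have xle : hn x <= hn xi + 1.
  have := hnD (x - xi) xi; rewrite subrK hnBC => h; apply: le_trans h _.
  by rewrite addrC lerD2l; apply: le_trans d1; apply: ltW.
(* This telescoping quantity controls both the difference of the two slices and that of the inner
   products. *)
have G : hn (xi - x) * hn eta + hn x * hn (eta - y) <= d * (hn xi + 1 + hn eta).
  rewrite mulrDr addrC; apply: lerD; last by rewrite ler_wpM2r ?hn_ge0 ?ltW.
  by rewrite mulrC ler_pM ?hn_ge0 ?(ltW yd).
have G0 : 0 <= hn (xi - x) * hn eta + hn x * hn (eta - y).
  by rewrite addr_ge0 ?mulr_ge0 ?hn_ge0.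
move: G G0; set g := hn (xi - x) * hn eta + hn x * hn (eta - y) => G G0.
have bnd : op_bound (CX * g) (T - S).
  apply: op_bound_of_form; first exact: mulr_ge0.
  move=> u v; rewrite -[(T - S) u]/(T u - S u) hdotBl hT hS.
  have -> : slice_form xi eta u v - slice_form x y u v =
      slice_form (xi - x) eta u v + slice_form x (eta - y) u v.
    by rewrite /slice_form !htensBr (BHB _ _ bX) hdotBl hdotBr; ring.
  apply: le_trans (Re_normD _ _) _.
  apply: le_trans (lerD (slice_form_le _ _ _ _) (slice_form_le _ _ _ _)) _.
  by rewrite le_eqVlt; apply/orP; left; apply/eqP; rewrite /g; ring.
have bTS : BH (T - S) by exact: BH_B.
have e1 : m T - hdot xi eta * l0 = m (T - S) - (hdot xi eta - hdot x y) * l0.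
  by rewrite mB // ES; ring.
have e2 : hdot xi eta - hdot x y = hdot (xi - x) eta + hdot x (eta - y).
  by rewrite hdotBl hdotBr; ring.
have e3 : Re `|hdot xi eta - hdot x y| <= g.
  rewrite e2; apply: le_trans (Re_normD _ _) _.
  by apply: lerD; exact: cauchy_schwarz.
rewrite e1; apply: le_trans (Re_normD _ _) _; rewrite normrN Re_normM.
have h1 := m_bound (mulr_ge0 CX0 G0) bTS bnd.
have h2 := ler_wpM2r (Re_norm_ge0 l0) e3.
apply: le_trans (lerD h1 h2) _.
have h3 := ler_wpM2l (addr_ge0 CX0 (Re_norm_ge0 l0)) G.
by apply: le_trans (le_trans h3 _); [|]; rewrite /B le_eqVlt; apply/orP; left;
  apply/eqP; ring.
Qed.

(** The series of |xi_n| |eta_n| converges, so the partial sums of vector slices tend to y in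
    operator norm. Norm continuity of m therefore suffices, and normality of m is never invoked. *)
Lemma slice_mean_series (V : set H) : dense V ->
  (forall xi eta, V xi -> V eta -> forall T, BH T ->
     (forall u v, hdot (T u) v = slice_form xi eta u v) -> m T = hdot xi eta * l0) ->
  forall (xi eta : nat -> H) y l, square_summable xi -> square_summable eta ->
    series_to (fun n => hdot (xi n) (eta n)) l -> BH y ->
    (forall u v, series_to (fun n => slice_form (xi n) (eta n) u v) (hdot (y u) v)) ->
    m y = l * l0.
Proof.
move=> dV hV xi eta y l [r hr] [r' hr'] hl by_ hy.
have /choice[T hT] : forall n, exists T, [/\ BH T, op_bound (CX * (hn (xi n) * hn (eta n))) T
    & forall u v, hdot (T u) v = slice_form (xi n) (eta n) u v].
  by move=> n; exact: slice_form_op.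
have mT n : m (T n) = hdot (xi n) (eta n) * l0.
  by have [bT _ eT] := hT n; exact: (slice_mean_vectors dV hV bT eT).
pose a n := hn (xi n) * hn (eta n).
have a0 n : 0 <= a n by rewrite mulr_ge0 ?hn_ge0.
have sq_le (z : nat -> H) (q : R[i]) :
    (forall n, \sum_(0 <= k < n) `|z k| ^+ 2 <= q) ->
    forall n, \sum_(0 <= k < n) hn (z k) ^+ 2 <= Re q.
  move=> h n; have := h n; rewrite lecE => /andP[_]; apply: le_trans.
  rewrite le_eqVlt; apply/orP; left; apply/eqP.
  elim: n => [|n IH]; first by rewrite !big_geq.
  by rewrite !big_nat_recr //= ReD -IH hnC -rmorphXn ReC.
(* Termwise, |xi_k| |eta_k| is at most half the sum of the squares. *)
have ar n : \sum_(0 <= k < n) a k <= (Re r + Re r') / 2.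
  have h1 := sq_le _ _ hr n; have h2 := sq_le _ _ hr' n.
  have : \sum_(0 <= k < n) a k <=
      \sum_(0 <= k < n) (hn (xi k) ^+ 2 / 2 + hn (eta k) ^+ 2 / 2).
    by apply: ler_sum => k _; have := sqr_ge0 (hn (xi k) - hn (eta k)); rewrite /a; nra.
  by rewrite big_split /= -!mulr_suml; lra.
pose S n := \sum_(0 <= k < n) T k.
have bT n : BH (T n) by case: (hT n).
have bS n : BH (S n) by exact: BH_sum.
have mS n : m (S n) = (\sum_(0 <= k < n) hdot (xi k) (eta k)) * l0.
  rewrite /S; elim: n => [|n IH].
    have m0 : m 0 = 0 by have := mZ 0 (BH_cst0 H); rewrite scale0r mul0r.
    by rewrite !big_geq // mul0r m0.
  rewrite !big_nat_recr //= mulrDl -IH -mT mD //; exact: BH_sum.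
have hS n u v : hdot (S n u) v = \sum_(0 <= k < n) slice_form (xi k) (eta k) u v.
  rewrite /S; elim: n => [|n IH].
    by rewrite !big_geq // -[(0 : H -> H) u]/(0 : H) hdot0l.
  rewrite !big_nat_recr //= -IH; case: (hT n) => _ _ <-.
  exact: hdotDl.
apply/eqP; rewrite -subr_eq0; apply/eqP/Re_norm_le0.
apply: (@le0_of_small0 _ _ (CX + Re `|l0|)) => d d0.
have [M1 hM1] := bounded_tail a0 ar d0.
have [M2 hM2] := series_toP hl d0.
pose n := maxn M1 M2.
have bnd : op_bound (CX * d) (y - S n).
  have CXd : 0 <= CX * d by rewrite mulr_ge0 // ltW.
  apply: op_bound_of_form => // u v; rewrite -[(y - S n) u]/(y u - S n u) hdotBl hS.
  rewrite -subr_le0; apply: (@le0_of_small0 _ _ 1) => d' d'0; rewrite mulr1.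
  have [M3 hM3] := series_toP (hy u v) d'0.
  (* The form converges only pointwise in u and v, so p depends on them; the block from n to p has a
     bound uniform in p. *)
  pose p := maxn n M3.
  have h3 := hM3 p (leq_maxr _ _).
  have e : hdot (y u) v - \sum_(0 <= k < n) slice_form (xi k) (eta k) u v =
      (hdot (y u) v - \sum_(0 <= k < p) slice_form (xi k) (eta k) u v)
      + \sum_(n <= k < p) slice_form (xi k) (eta k) u v.
    by rewrite [\sum_(0 <= k < p) _](@big_cat_nat _ _ _ n) ?leq_maxl //=; ring.
  rewrite e lerBlDr; apply: le_trans (Re_normD _ _) _; apply: lerD h3 _.
  have : \sum_(n <= k < p) a k <= d by apply: hM1; exact: leq_maxl.
  have -> : CX * d * hn u * hn v = d * (CX * hn u * hn v) by ring.
  have q0 : 0 <= CX * hn u * hn v by rewrite !mulr_ge0 ?hn_ge0.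
  move=> /(ler_wpM2r q0); apply: le_trans; rewrite mulr_suml.
  elim: p {e} => [|p IH]; first by rewrite !big_geq // normr0.
  have [np|pn] := leqP n p; last by rewrite !big_geq // normr0.
  rewrite !big_nat_recr //=; apply: le_trans (Re_normD _ _) _; apply: lerD IH _.
  apply: le_trans (slice_form_le _ _ _ _) _.
  by rewrite le_eqVlt; apply/orP; left; apply/eqP; rewrite /a; ring.
have e1 : m y - l * l0 = m (y - S n) - (l - \sum_(0 <= k < n) hdot (xi k) (eta k)) * l0.
  by rewrite mB // mS; ring.
rewrite e1; apply: le_trans (Re_normD _ _) _; rewrite normrN Re_normM.
have h1 : Re `|m (y - S n)| <= CX * d.
  by apply: m_bound bnd; [rewrite mulr_ge0 // ltW | exact: BH_B].
have h2 := ler_wpM2r (Re_norm_ge0 l0) (hM2 n (leq_maxr _ _)).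
by apply: le_trans (lerD h1 h2) _; rewrite mulrDr (mulrC CX).
Qed.

End SliceMean.

Section DenseRange.
Variables (R : realType) (H : hilbertType R).

Lemma hdot_ext_dense (V : set H) (x x' : H) : dense V ->
  (forall y, V y -> hdot x y = hdot x' y) -> x = x'.
Proof.
move=> dV h; apply/eqP; rewrite -subr_eq0; apply/eqP/hn_le0.
set w := x - x'; have hw y : V y -> hdot w y = 0 by move=> Vy; rewrite hdotBl h // subrr.
suff -> : hn w = 0 by [].
apply/sqr_le0/(@le0_of_small0 _ _ (hn w)) => d d0.
have [y Vy wy] := dense_hn w dV d0.
rewrite -[leLHS]ReC -hdotxx; have -> : hdot w w = hdot w (w - y) by rewrite hdotBr (hw y Vy) subr0.
by apply: le_trans (Re_hdot_le _ _) _; rewrite mulrC ler_wpM2r ?hn_ge0 ?ltW.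
Qed.

End DenseRange.

(** * The invariant mean *)

Section GNS.
Variables (R : realType) (A : starAlgType R) (phi : {scalar A}) (H : hilbertType R).
Variables (Lambda : {linear A -> H}) (pi : A -> H -> H) (e : A).
Hypotheses (unit_e : is_unit e) (tr : tracial phi).
Hypotheses (gns : gns_pair phi Lambda) (rep : gns_rep Lambda pi).
Let M := bicommutant (range pi).
Let bpi a : BH (pi a). Proof. by case: rep. Qed.

Lemma rep_unit : pi e = id.
Proof.
case: gns rep => dL _ [_ _ _ _ piL]; apply: (dense_BH_eq dL) => //; first exact: BH_id.
by move=> _ [a _ <-]; rewrite piL (unit_e a).1.
Qed.

Lemma rep_in a : M (pi a).
Proof. by split=> // S [_ cS]; rewrite cS //; exists a. Qed.

(** Traciality makes the star isometric on the range of [Lambda]. Right multiplication by a is left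
    multiplication by its star conjugated by that isometry, hence bounded. The last clause computes
    its adjoint at the unit vector. *)
Lemma right_multiplication a : exists T,
  [/\ commutant (range pi) T, forall b, T (Lambda b) = Lambda (b ∙ a)
    & forall x, hdot (T x) (Lambda e) = hdot x (Lambda a^⋆)].
Proof.
case: gns rep => dL gL [_ _ piM pia piL].
have [C C0 hC] := BH_bound (bpi a^⋆).
have lf : linear (fun b => Lambda (b ∙ a)).
  by move=> k b c; rewrite amulDl amulZl linearP.
have norm_star b : hn (Lambda b^⋆) = hn (Lambda b).
  apply/eqP; rewrite -(@eqrXn2 _ 2%N) ?hn_ge0 //; apply/eqP/complexI.
  by rewrite -[LHS]hdotxx -[RHS]hdotxx !gL astarK tr.
have [b|T bT TL] := dense_extension C0 dL lf.
  rewrite -norm_star astarM -piL; apply: le_trans (hC _) _.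
  by rewrite norm_star.
exists T; split=> // [|x].
  split=> // _ [c _ <-]; apply: (dense_BH_eq dL); [exact: BH_comp|exact: BH_comp|].
  by move=> _ [b _ <-] /=; rewrite TL !piL TL amulA.
have [S bS aS] := adjoint_exists bT; rewrite aS; congr (hdot x _).
apply: (hdot_ext_dense dL) => _ [b _ <-].
by rewrite (adjoint_sym aS) TL !gL (unit_e _).2 astarM tr.
Qed.

(** With T right multiplication by a and Om the unit vector, (a X Om, Om) = (T X Om, Om) = (X T Om,
    Om) = (X a Om, Om), since X commutes with T. *)
Lemma vstate_rep_trace a X : M X ->
  vstate (Lambda e) (pi a \o X) = vstate (Lambda e) (X \o pi a).
Proof.
move=> [bX cX]; have [T [cT TL aT]] := right_multiplication a.
case: rep => _ _ _ pia piL; rewrite /vstate /=.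
have [ue1 ue2] := unit_e a; have [us1 us2] := unit_e a^⋆.
rewrite pia !piL ue2 us2 -aT -[in RHS]ue1 -TL.
by rewrite -[T (X _)]/((T \o X) _) -(cX _ cT).
Qed.

End GNS.

(** Idempotence and the prescribed range make E the identity on N; rescaling to the unit ball turns
    norm one into preservation of every operator bound. *)
Lemma injective_vN_contractive (R : realType) (H : hilbertType R) (N : set (H -> H)) :
  N `<=` @BH R H -> injective_vN N ->
  exists E : (H -> H) -> (H -> H),
  [/\ forall (k : R[i]) S T, BH S -> BH T -> E (k *: S + T) = k *: E S + E T,
      forall T, BH T -> N (E T), forall T, N T -> E T = T
    & forall T C, 0 <= C -> BH T -> op_bound C T -> op_bound C (E T)].
Proof.
move=> NBH [E [Elin Eid Erng Esup]]; exists E.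
have Ein T : BH T -> N (E T) by move=> bT; rewrite -Erng; exists T.
have EZ k T : BH T -> E (k *: T) = k *: E T.
  move=> bT; have E0 : E 0 = 0.
    by have := Elin (-1) 0 0 (BH_cst0 H) (BH_cst0 H); rewrite scaleN1r addNr scaleN1r addNr.
  by have := Elin k T 0 bT (BH_cst0 H); rewrite E0 !addr0.
split=> // [T|T C C0 bT hT x].
  by rewrite -Erng => -[S bS <-]; exact: Eid.
(* The supremum of a set without one is 0 by convention, so the value 1 forces the set to be
   bounded. *)
have [supP|/sup_out s0] :=
  pselect (has_sup [set opnorm (E T) | T in [set T | BH T /\ opnorm T <= 1]]); last first.
  by move: Esup; rewrite s0 => /eqP; rewrite eq_sym oner_eq0.
have contr1 S : BH S -> opnorm S <= 1 -> op_bound 1 (E S).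
  move=> bS hS z; apply: le_trans (op_bound_opnorm (NBH _ (Ein _ bS)) z) _.
  rewrite ler_wpM2r ?hn_ge0 // -Esup; apply: ub_le_sup; first exact: supP.2.
  by exists S.
rewrite -subr_le0; apply: (@le0_of_small0 _ _ (hn x)) => d d0.
(* Adding d makes the scaling factor invertible when C = 0. *)
have Cd0 : 0 < C + d by lra.
pose S := ((C + d)^-1)%:C *: T.
have bS : BH S by exact: BH_Z.
have hS : op_bound 1 S.
  move=> z; have := op_boundZ ((C + d)^-1)%:C hT z; rewrite Re_normC ger0_norm; last first.
    by rewrite invr_ge0 ltW.
  move/le_trans; apply; rewrite ler_wpM2r ?hn_ge0 // mulrC ler_pdivrMr //; lra.
have := contr1 S bS (opnorm_le bS hS ler01) x; rewrite mul1r EZ //.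
rewrite -[(_ *: E T) x]/(_ *: E T x) hnZ Re_normC ger0_norm; last by rewrite invr_ge0 ltW.
by rewrite mulrC ler_pdivrMr //; lra.
Qed.

(* A contractive functional that takes the value 1 at the identity is positive:
   compare it with [c - T^* T] for [c = C^2], [C] a bound of [T]. *)
Lemma contractive_positive (R : realType) (H : hilbertType R) (m : (H -> H) -> R[i]) T S :
  (forall S T, BH S -> BH T -> m (S + T) = m S + m T) ->
  (forall k T, BH T -> m (k *: T) = k * m T) ->
  (forall T C, 0 <= C -> BH T -> op_bound C T -> Re `|m T| <= C) ->
  m id = 1 -> (forall h, BH h -> adjoint_pair h h -> Im (m h) = 0) ->
  BH T -> adjoint_pair T S -> 0 <= m (S \o T).
Proof.
move=> mD mZ mB m1 mI bT aTS; have bS := adjoint_BH bT aTS.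
have [C C0 hC] := BH_bound bT; have hS := adjoint_bound C0 hC aTS.
have bST : BH (S \o T) by exact: BH_comp.
rewrite lecE ImC ReC mI //=; last first.
  by apply: adjoint_comp => //; exact: adjoint_sym.
rewrite eqxx /=; pose c := C ^+ 2.
have c0 : 0 <= c by rewrite sqr_ge0.
have bI := @BH_id _ H.
pose P := c%:C *: (id : H -> H) - (S \o T).
have bP : BH P by apply: BH_B => //; exact: BH_Z.
(* The square of |P x| is c^2 |x|^2 - 2 c |T x|^2 + |S T x|^2, and the last term is at most c |T
   x|^2. Contractivity then gives |c - m(S T)| <= c, so Re m(S T) >= 0. *)
have hP : op_bound c P.
  move=> x; rewrite -(@ler_pXn2r _ 2%N) ?nnegrE ?mulr_ge0 ?hn_ge0 //.
  rewrite -[P x]/(c%:C *: x - S (T x)) hnB2 hnZ Re_normC (ger0_norm c0) hdotZl.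
  rewrite -aTS hdotxx ReM !ReC !ImC mulr0 subr0.
  have h : hn (S (T x)) ^+ 2 <= c * hn (T x) ^+ 2.
    by rewrite -exprMn ler_pXn2r ?nnegrE ?mulr_ge0 ?hn_ge0.
  have : 0 <= c * hn (T x) ^+ 2 by rewrite mulr_ge0 ?sqr_ge0.
  by lra.
have := mB P c c0 bP hP.
have mN : m (- (S \o T)) = - m (S \o T) by rewrite -[- _]scaleN1r mZ // mulN1r.
rewrite (mD _ _ (BH_Z _ bI) (BH_N bST)) (mZ _ _ bI) m1 mN mulr1.
have := abs_Re_le (c%:C - m (S \o T)); rewrite ReD ReN ReC.
by rewrite ler_norml => /andP[h1 h2] h3; lra.
Qed.

(** * Right invariance of the mean on the dual *)

Theorem theorem4p9 (R : realType) (A : starAlgType R)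
    (Delta : A -> tensor A A -> tensor A A) (phi : {scalar A})
    (H HH : hilbertType R) (Lambda : {linear A -> H}) (t : H -> H -> HH)
    (pi : A -> H -> H) (W : HH -> HH) (pih : (A -> R[i]) -> H -> H) :
  compact_type Delta ->
  haar_state Delta phi ->
  tracial phi ->
  gns_pair phi Lambda ->
  gns_rep Lambda pi ->
  hilbert_tensor t ->
  multiplicative_unitary Delta Lambda t W ->
  dual_rep Delta phi Lambda pih ->
  injective_vN (bicommutant (range pi)) ->
  dual_amenable phi t pih W.
Proof.
move=> [[hopf _] [e unit_e]] [[_ _ li] phi1] tr gns rep ht [[lW Wsurj Wdot] hW] _ inj.
have [dL gL] := gns; have [bpi lpi piM pia piL] := rep.
have [D [Dl DM DS]] := compact_coproduct hopf unit_e.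
set M := bicommutant (range pi) in inj.
have bY : commutant (range pi) `<=` @BH R H by move=> T [].
have [E [Elin Ein Efix Econtr]] := injective_vN_contractive (@commutant_BH _ _ _) inj.
pose Om := Lambda e.
have Om1 : hn Om = 1.
  apply/eqP; rewrite -(@eqrXn2 _ 2%N) ?hn_ge0 // expr1n; apply/eqP/complexI.
  by rewrite -[LHS]hdotxx gL (unit_star unit_e) (unit_e e).1 phi1.
pose m T := vstate Om (E T).
have mD S T : BH S -> BH T -> m (S + T) = m S + m T.
  by move=> bS bT; rewrite /m (cexpD Elin) // vstateD.
have mZ k T : BH T -> m (k *: T) = k * m T.
  by move=> bT; rewrite /m (cexpZ bY Elin Efix) // vstateZ.
have mB T C : 0 <= C -> BH T -> op_bound C T -> Re `|m T| <= C.
  exact: (vstate_cexp_bound Econtr Om1).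
have m1 : m id = 1.
  by rewrite /m Efix /vstate /= ?hdotxx ?Om1 ?expr1n //; exact: commutant_id.
have hyper a T : BH T -> m (pi a \o T) = m (T \o pi a).
  move=> bT; apply: (hypertrace bY Elin Ein Efix Econtr Om1 (rep_in rep a)
    (rep_in rep a^⋆) (pia a) _ _ bT) => X; exact: (vstate_rep_trace unit_e tr gns rep).
exists m; split.
  split=> [k S T [bS _] [bT _]|T S [bT _] aTS|//].
    by rewrite mD ?mZ //; exact: BH_Z.
  apply: (contractive_positive mD mZ mB m1) bT aTS => h bh ah.
  apply: selfadjoint_Im; have := cexp_adjoint bY Elin Ein Efix Econtr bh ah.
  exact.
move=> x w X y [bx _] _ [Z [bZ hZ] XW] [by_ [p [sq1 sq2 hw] hy]].
have [CZ CZ0 hCZ] := BH_bound bZ.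
have WD z z' : W (z + z') = W z + W z' by have := lW 1 z z'; rewrite !scale1r.
have Wn z : hn (W z) = hn z.
  apply/eqP; rewrite -(@eqrXn2 _ 2%N) ?hn_ge0 //; apply/eqP/complexI.
  by rewrite -[LHS]hdotxx -[RHS]hdotxx Wdot.
have XWE z : X (W z) = W (Z z) by exact: (congr1 (fun f => f z) XW).
(* [is_comul] fixes X only through X W = W Z; surjectivity and isometry of W transfer the bound and
   the linearity of Z to X. *)
have hX : op_bound CZ X.
  move=> z; have [z' <-] := Wsurj z; rewrite XWE !Wn; exact: hCZ.
have bX : BH X.
  apply: bounded_BH hX => k z1 z2.
  have [z1' <-] := Wsurj z1; have [z2' <-] := Wsurj z2.
  by rewrite -lW !XWE bZ.1 lW.
(* The defining relation of W, with the tensor [D c] expanded, exhibits the preimage of a pair of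
   GNS vectors as a finite sum. *)
have We a c : t (Lambda a) (Lambda c) =
    W (\sum_(q <- repr (D c)) t (pi q.1 (Lambda a)) (Lambda q.2)).
  rewrite -(hW a c _ (Dl c a)); congr W.
  have bt : balanced (fun c d => t (Lambda c) (Lambda d)).
    have [tl tr' _ _] := ht; split=> [b b' d|b d d'|k b d].
    - by rewrite linearD (htensDl ht).
    - by rewrite linearD (htensDr ht).
    - have tZl u v : t (k *: u) v = k *: t u v.
        have t0 : t 0 v = 0 by apply: (addrI (t 0 v)); rewrite -(htensDl ht) !addr0.
        by have := tl v k u 0; rewrite t0 !addr0.
      have tZr u v : t u (k *: v) = k *: t u v.
        have t0 : t u 0 = 0 by apply: (addrI (t u 0)); rewrite -(htensDr ht) !addr0.
        by have := tr' u k v 0; rewrite t0 !addr0.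
      by rewrite !linearZ /= tZl tZr.
  rewrite [in LHS](tensor_sum (D c)) amul_suml (tlift_sum _ _ bt).
  apply: eq_bigr => q _; rewrite tensM tlift_tens // piL.
  by rewrite (unit_e q.2).2.
pose slice c d : H -> H := \sum_(q <- repr (D c)) \sum_(q' <- repr (D d))
  phi (q'.2^⋆ ∙ q.2) *: (pi q'.1^⋆ \o (x \o pi q.1)).
have bterm (q q' : A * A) : BH (pi q'.1^⋆ \o (x \o pi q.1)).
  by do 2 apply: BH_comp => //.
have bslice c d : BH (slice c d).
  by apply: BH_sum => q; apply: BH_sum => q'; exact: BH_Z.
have m_sum I (s : seq I) (F : I -> H -> H) : (forall i, BH (F i)) ->
    m (\sum_(i <- s) F i) = \sum_(i <- s) m (F i).
  move=> bF; elim: s => [|i s IH].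
    by rewrite !big_nil; have := mZ 0 0 (BH_cst0 H); rewrite scale0r mul0r.
  by rewrite !big_cons mD ?IH //; exact: BH_sum.
have mslice c d : m (slice c d) = hdot (Lambda c) (Lambda d) * m x.
  (* By [hyper] the factor from d moves to the far right, so every term becomes a value of the
     linear functional g; the arguments sum to a multiple of e by [invariance_sum]. *)
  pose g a := m (x \o pi a).
  have gD a b : g (a + b) = g a + g b.
    have := lpi 1 a b; rewrite !scale1r /g => ->.
    by rewrite (compDr _ _ bx) mD //; exact: BH_comp.
  have gZ k a : g (k *: a) = k * g a.
    have pi0 : pi 0 = 0.
      by apply: (addrI (pi 0)); have := lpi 1 0 0; rewrite !scale1r !addr0 => <-.
    have := lpi k a 0; rewrite pi0 !addr0 /g => ->.
    by rewrite (compZr _ _ bx) mZ //; exact: BH_comp.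
  have g_sum I (s : seq I) (F : I -> A) : g (\sum_(i <- s) F i) = \sum_(i <- s) g (F i).
    elim: s => [|i s IH]; first by rewrite !big_nil; have := gZ 0 0; rewrite scale0r mul0r.
    by rewrite !big_cons gD IH.
  rewrite gL.
  have -> : m x = g e by rewrite /g (rep_unit unit_e gns rep).
  rewrite -gZ -(invariance_sum unit_e c d li tr Dl DM DS) g_sum /slice m_sum; last first.
    by move=> q; apply: BH_sum => q'; exact: BH_Z.
  apply: eq_bigr => q _; rewrite g_sum m_sum; last by move=> q'; exact: BH_Z.
  apply: eq_bigr => q' _; rewrite gZ mZ //; congr (_ * _).
  rewrite hyper; last exact: BH_comp.
  by rewrite /g piM compA.
(* Both vectors are written through [We]; W cancels by isometry, and Z acts on the first leg
   only. *)
have slice_dot c d a b : hdot (slice c d (Lambda a)) (Lambda b) =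
    hdot (X (t (Lambda a) (Lambda c))) (t (Lambda b) (Lambda d)).
  rewrite !We XWE Wdot.
  have Zsum I (s : seq I) (F : I -> HH) : Z (\sum_(i <- s) F i) = \sum_(i <- s) Z (F i).
    elim: s => [|i s IH]; first by rewrite !big_nil BH0.
    by rewrite !big_cons BHD // IH.
  have sumE I (s : seq I) (F : I -> H -> H) v : (\sum_(i <- s) F i) v = \sum_(i <- s) F i v.
    by elim: s => [|i s IH]; rewrite ?big_nil ?big_cons // -IH.
  rewrite Zsum hdot_suml /slice sumE hdot_suml; apply: eq_bigr => q _.
  rewrite hdot_sumr sumE hdot_suml; apply: eq_bigr => q' _.
  case: ht => _ _ td _; rewrite hZ td gL.
  rewrite -[(_ *: _) _]/(phi (q'.2^⋆ ∙ q.2) *: pi q'.1^⋆ (x (pi q.1 (Lambda a)))).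
  by rewrite hdotZl (adjoint_sym (pia q'.1)) mulrC.
apply: (slice_mean_series ht CZ0 bX hX mD mZ mB dL _ sq1 sq2 _ by_ hy).
- move=> _ _ [c _ <-] [d _ <-] T bT hT; rewrite -mslice; congr m.
  apply: (dense_BH_eq dL bT (bslice c d)) => _ [a _ <-].
  by apply: (hdot_ext_dense dL) => _ [b _ <-]; rewrite hT slice_dot.
(* The representation of w evaluated at the identity is the series of the inner products (xi_n,
   eta_n). *)
- exact: (hw id (commutant_id _)).
Qed.
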